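(* Let $\Omega\subseteq\mathbb{R}^d$ be open, $p\in[1,\infty)$, $m\in\mathbb{N}$, $V=\{w_\alpha\}_{\alpha\in\pi_m}$ a family of elements of $E_p(\Omega)$, and $v\in\mathcal{C}^{m,*}(\Omega)$. Assume that for every $\alpha\in\pi_m$ and every $K\Subset\Omega$ there is $C_K>0$ with $|v(x)|^{|\alpha|+1}\le C_K|w_\alpha(x)|$ for a.e. $x\in K$. Then the normed space $W^{m,p}_{V,v}(\Omega)$ is complete (a Banach space).
   Context: Throughout, $\Omega\subseteq\mathbb{R}^d$ is open, $\mathbb{N}=\{0,1,2,\dots\}$, $p\in[1,\infty)$, $K\Subset\Omega$ means $K$ is a compact subset of $\Omega$, $\pi_m=\{\alpha\in\mathbb{N}^d:|\alpha|\le m\}$ and $\pi_m^0=\pi_m\setminus\{0\}$. A weight on $\Omega$ is a locally integrable function positive a.e.; $E_p(\Omega)$ is the set of measurable $w$ with $|w|^p$ a weight. For measurable $u$, $L^p_u(\Omega)$ is the space of measurable $f$ with $fu\in L^p(\Omega)$, normed by $\|fu\|_{L^p}$; $L^p_{u,\mathrm{loc}}$ means $fu\in L^p(K)$ for all $K\Subset\Omega$. $\mathcal{C}^{k,*}(\Omega)$ is the set of $v\in\mathcal{C}^k(\Omega)$ with $v\ne0$ a.e. Condition (H) for $v$ with respect to $w$: for every $K\Subset\Omega$ there is $C>0$ with $|v|\le C|w|$ a.e. in $K$. Weak derivative in the sense of $L^1_{v,\mathrm{loc}}(\Omega)$: for $|\alpha|\ge1$, $w\in E_p(\Omega)$ and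 $v\in\mathcal{C}^{|\alpha|,*}(\Omega)$ satisfying (H) w.r.t. $w$, $f\in L^1_{w,\mathrm{loc}}(\Omega)$ has such a derivative if there is $g\in L^1_{v^{|\alpha|+1},\mathrm{loc}}(\Omega)$ with $\int_\Omega f\,\partial^\alpha(v^{|\alpha|+1}\phi)\,dx=(-1)^{|\alpha|}\int_\Omega v^{|\alpha|+1}\phi\,g\,dx$ for all $\phi\in C_c^\infty(\Omega)$; $g=:D^\alpha_vf$ is unique; $D^0_vf:=f$. For $m\in\mathbb{N}$, $V=\{w_\alpha\}_{\alpha\in\pi_m}\subset E_p(\Omega)$ and $v\in\mathcal{C}^{m,*}(\Omega)$ satisfying (H) w.r.t. $w_0$, the space $W^{m,p}_{V,v}(\Omega)$ consists of all $f\in L^p_{w_0}(\Omega)$ such that for every $\alpha\in\pi_m^0$, $D^\alpha_vf$ exists and lies in $L^p_{w_\alpha}(\Omega)$; norm $\|f\|_{W^{m,p}_{V,v}}=\big(\sum_{\alpha\in\pi_m}\|w_\alpha D^\alpha_vf\|_{L^p}^p\big)^{1/p}$. (The hypothesis with $\alpha=0$ gives (H) w.r.t. $w_0$.) *)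

(* Defs.v *)
From HB Require Import structures.
From mathcomp Require Import all_boot all_order all_algebra.
From mathcomp Require Import all_classical all_reals all_analysis.

Set Implicit Arguments.
Unset Strict Implicit.
Unset Printing Implicit Defensive.
Import Order.TTheory GRing.Theory Num.Theory.
Import numFieldNormedType.Exports.
Local Open Scope classical_set_scope.
Local Open Scope ring_scope.

(* a copy of a type on which every subset is "measurable"; used only as
   the covering family for the outer-measure construction mu_ext *)
Definition allsets (T : Type) : Type := T.
HB.instance Definition _ (T : pointedType) := Pointed.on (allsets T).
HB.instance Definition _ (T : pointedType) :=
  @isMeasurable.Build default_measure_display (allsets T)
    discrete_measurable discrete_measurable0
    discrete_measurableC discrete_measurableU.

Section LebesgueRd.
Variables (R : realType) (d : nat).

Definition box (a b : 'rV[R]_d) : set 'rV[R]_d :=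
  [set x | forall i : 'I_d, a ord0 i < x ord0 i <= b ord0 i].

Definition boxvol (a b : 'rV[R]_d) : R := \prod_(i < d) (b ord0 i - a ord0 i).

(* volume of a set which is a box (+oo on sets which are not boxes) *)
Definition box_content (A : set (allsets 'rV[R]_d)) : \bar R :=
  if `[< A = set0 >] then 0%E else
  ereal_inf [set x | exists a b : 'rV[R]_d,
    [/\ forall i, a ord0 i <= b ord0 i, A = box a b & x = (boxvol a b)%:E]].

Lemma box_content_ge0 A : (0 <= box_content A)%E.
Proof.
rewrite /box_content; case: asboolP => // _.
apply: le_ereal_inf_tmp => _ [a [b [ab _ ->]]].
rewrite lee_fin; apply: prodr_ge0 => i _; rewrite subr_ge0; exact: ab.
Qed.

Lemma box_content0 : box_content set0 = 0%E.
Proof. by rewrite /box_content; case: asboolP. Qed.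

Definition lebesgue_outer : set (allsets 'rV[R]_d) -> \bar R :=
  mu_ext box_content.

HB.instance Definition _ := isOuterMeasure.Build R (allsets 'rV[R]_d)
  lebesgue_outer
  (mu_ext0 box_content0 box_content_ge0)
  (mu_ext_ge0 box_content_ge0)
  (le_mu_ext box_content)
  (mu_ext_sigma_subadditive box_content_ge0).

Definition lebesgue_outer_om : {outer_measure set (allsets 'rV[R]_d) -> \bar R}
  := lebesgue_outer.
Definition Rd : Type := caratheodory_type lebesgue_outer_om.

Definition lebesgue_d : {measure set Rd -> \bar R} :=
  [the measure _ _ of (lebesgue_outer_om : set Rd -> \bar R)].

End LebesgueRd.

Section WeightedSobolev.
Variables (R : realType) (d : nat).
Local Notation Vd := 'rV[R]_d.
Local Notation mu := (lebesgue_d R d).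
Local Open Scope ereal_scope.

Definition compact_in (Omega K : set Vd) : Prop := compact K /\ K `<=` Omega.

Definition lmeasurable (D : set Vd) (f : Vd -> R) : Prop :=
  @measurable_fun _ _ (Rd R d) R D f.

Definition mlen (a : 'I_d -> nat) : nat := (\sum_(i < d) a i)%N.

Definition evec (i : 'I_d) : Vd := delta_mx ord0 i.
Definition partial (i : 'I_d) (f : Vd -> R) : Vd -> R :=
  fun x => 'D_(evec i) f x.
Definition dpart (a : 'I_d -> nat) (f : Vd -> R) : Vd -> R :=
  foldr (fun i g => iter (a i) (partial i) g) f (enum 'I_d).

Definition Ck (k : nat) (Omega : set Vd) (f : Vd -> R) : Prop :=
  forall a : 'I_d -> nat, (mlen a <= k)%N -> forall x, Omega x ->
    {for x, continuous (dpart a f)} /\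
    ((mlen a < k)%N -> forall i, derivable (dpart a f) x (evec i)).

Definition Ckstar (k : nat) (Omega : set Vd) (v : Vd -> R) : Prop :=
  Ck k Omega v /\ {ae mu, forall x, Omega x -> v x != 0%R}.

Definition Ccinf (Omega : set Vd) (phi : Vd -> R) : Prop :=
  (forall k, Ck k Omega phi) /\
  compact_in Omega (closure [set x | phi x != 0%R]).

Definition loc_integrable (Omega : set Vd) (u : Vd -> R) : Prop :=
  lmeasurable Omega u /\
  forall K, compact_in Omega K -> \int[mu]_(x in K) (`|u x|)%:E < +oo.

Definition weight (Omega : set Vd) (u : Vd -> R) : Prop :=
  loc_integrable Omega u /\ {ae mu, forall x, Omega x -> (0 < u x)%R}.

Definition Ep (p : R) (Omega : set Vd) (w : Vd -> R) : Prop :=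
  lmeasurable Omega w /\ weight Omega (fun x => `|w x| `^ p)%R.

Definition Lpw (p : R) (Omega : set Vd) (u f : Vd -> R) : Prop :=
  lmeasurable Omega f /\
  \int[mu]_(x in Omega) ((`|f x * u x| `^ p)%R)%:E < +oo.

Definition L1wloc (Omega : set Vd) (u f : Vd -> R) : Prop :=
  lmeasurable Omega f /\
  forall K, compact_in Omega K -> \int[mu]_(x in K) (`|f x * u x|)%:E < +oo.

Definition condH (Omega : set Vd) (v w : Vd -> R) : Prop :=
  forall K, compact_in Omega K -> exists C : R, (0 < C)%R /\
    {ae mu, forall x, K x -> (`|v x| <= C * `|w x|)%R}.

Definition is_wder (Omega : set Vd) (w v : Vd -> R) (a : 'I_d -> nat)
    (f g : Vd -> R) : Prop :=
  L1wloc Omega w f /\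
  L1wloc Omega (fun x => v x ^+ (mlen a).+1)%R g /\
  forall phi, Ccinf Omega phi ->
    \int[mu]_(x in Omega)
        (f x * dpart a (fun y => v y ^+ (mlen a).+1 * phi y) x)%:E
    = ((-1) ^+ mlen a)%:E *
      \int[mu]_(x in Omega) (v x ^+ (mlen a).+1 * phi x * g x)%:E.

(* D^alpha_v f (a chosen representative; D^0_v f = f) *)
Definition Dv (Omega : set Vd) (w v : Vd -> R) (a : 'I_d -> nat)
    (f : Vd -> R) : Vd -> R :=
  if mlen a == 0%N then f else get [set g | is_wder Omega w v a f g].

Definition alpha0 : 'I_d -> nat := fun=> 0%N.

Definition Wmem (p : R) (m : nat) (Omega : set Vd)
    (W : ('I_d -> nat) -> Vd -> R) (v : Vd -> R) (f : Vd -> R) : Prop :=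
  Lpw p Omega (W alpha0) f /\
  forall a : 'I_d -> nat, (0 < mlen a <= m)%N ->
    (exists g, is_wder Omega (W alpha0) v a f g) /\
    Lpw p Omega (W a) (Dv Omega (W alpha0) v a f).

(* the norm of W^{m,p}_{V,v}(Omega); pi_m is enumerated as the
   functions a : 'I_d -> 'I_m.+1 with |a| <= m *)
Definition Wnorm (p : R) (m : nat) (Omega : set Vd)
    (W : ('I_d -> nat) -> Vd -> R) (v : Vd -> R) (f : Vd -> R) : R :=
  (fine (\sum_(a : {ffun 'I_d -> 'I_m.+1} |
                (mlen (fun i => nat_of_ord (a i)) <= m)%N)
      \int[mu]_(x in Omega)
        ((`|W (fun i => nat_of_ord (a i)) x *
            Dv Omega (W alpha0) v (fun i => nat_of_ord (a i)) f x| `^ p)%R)%:E)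
   `^ p^-1)%R.

End WeightedSobolev.

(* Main.v *)
(* A Cauchy sequence [u n] makes each [W a * D^a (u n)] Cauchy in L^p, with limit
   [h a]; since [W a <> 0] a.e., put [g a = h a / W a] and [f = g 0].  It remains
   to see that [g a] is the weak derivative of [f], i.e. to pass to the limit in
     int (u n) * d^a (v^(|a|+1) phi) = (-1)^|a| int v^(|a|+1) * phi * D^a (u n).
   Each derivative destroys at most one factor [v], so
   [d^a (v^(|a|+1) phi) = v * psi] with [psi] continuous and supported in the
   compact support of [phi]; there [|v| <= C |W 0|] and [|v|^(|a|+1) <= C |W a|],
   so both sides converge by local L^1 convergence.
   The weak derivative chosen in [Dv] is linear only up to null sets, by
   uniqueness: an h in L^1_loc with [int phi h = 0] for all test functions has
   integral zero over every small box (products of the functions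
   [exp (-1/t)] converge boundedly to indicators of boxes), hence over the
   sigma-algebra generated by boxes, hence vanishes a.e. *)
Require Import Defs.
From HB Require Import structures.
From mathcomp Require Import all_boot all_order all_algebra.
From mathcomp Require Import all_classical all_reals all_analysis.
From mathcomp Require Import measurable_realfun.
From mathcomp Require Import ring lra.
Import Order.TTheory GRing.Theory Num.Theory.
Import numFieldNormedType.Exports.
Local Open Scope classical_set_scope.
Local Open Scope ring_scope.
Set Implicit Arguments.
Unset Strict Implicit.
Unset Printing Implicit Defensive.

(** * Boxes, open sets and compact sets for the Lebesgue measure *)

Section lebesgue_space.
Context {R : realType} {d : nat}.
Local Notation Vd := 'rV[R]_d.
Local Notation mu := (lebesgue_d R d).

(** The measure is the Caratheodory extension of the volume of half-open boxes, so its measurable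
    sets may go beyond the sigma-algebra generated by boxes, and the two are linked only through
    covers: hyperplanes split covers, which makes boxes measurable, and every set of finite measure
    has a hull of equal measure in the sigma-algebra of boxes. That hull carries vanishing integrals
    from boxes to arbitrary measurable sets.

    The exponent |a|+1 is matched to the order: |a| derivatives leave at least one factor [v], the
    one that (H) bounds by [W 0]. The stronger bound on |v|^(|a|+1) serves the other side, where
    [g a] must be locally integrable against v^(|a|+1).

    Because [Dv] is a choice, the derivative of a difference must first be identified almost
    everywhere before the Cauchy property of the norms says anything about [W a * D^a (u n)]; this
    is where [v != 0] a.e. enters.

    The passage from L^p to local L^1 rests on |t| <= e + e (1/e)^p |t|^p, which takes the place of
    the Hoelder inequality and treats p = 1 and p > 1 alike. *)

Definition halfspace (i : 'I_d) (c : R) : set Vd := [set x | x ord0 i <= c].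

Lemma box_content_le (a b : Vd) : (forall i, a ord0 i <= b ord0 i) ->
  (box_content (box a b) <= (boxvol a b)%:E)%E.
Proof.
move=> ab; rewrite /box_content; case: asboolP => _.
  by rewrite lee_fin; apply: prodr_ge0 => i _; rewrite subr_ge0.
by apply: ereal_inf_lbound; exists a, b.
Qed.

(** The hyperplane x_i = c cuts a box into two boxes that differ from it only in the i-th side. The
    half-open convention makes both pieces exact boxes, so the volumes add up. *)
Lemma box_content_halfspace (i : 'I_d) (c : R) (A : set Vd) :
  (box_content (A `&` halfspace i c) + box_content (A `&` ~` halfspace i c)
    <= box_content A)%E.
Proof.
rewrite {3}/box_content; case: asboolP => [->|A0].
  by rewrite !set0I !box_content0 adde0.
apply: le_ereal_inf_tmp => _ [a [b [ab AE ->]]]; rewrite {}AE {A A0}.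
have [cai|aic] := leP c (a ord0 i).
  have -> : box a b `&` halfspace i c = set0.
    rewrite -subset0 => x [/(_ i) /andP[ax _]]; rewrite /halfspace /= => xc; exfalso; lra.
  rewrite box_content0 add0e (_ : _ `&` _ = box a b); first exact: box_content_le.
  apply/setIidPl => x /(_ i) /andP[ax _]; rewrite /halfspace /= => xc; lra.
have [bic|cbi] := leP (b ord0 i) c.
  have -> : box a b `&` ~` halfspace i c = set0.
    rewrite -subset0 => x [/(_ i) /andP[_ xb]]; apply.
    by rewrite /halfspace /=; lra.
  rewrite box_content0 adde0 (_ : _ `&` _ = box a b); first exact: box_content_le.
  by apply/setIidPl => x /(_ i) /andP[_ xb]; rewrite /halfspace /=; lra.
pose b' : Vd := \row_j if j == i then c else b ord0 j.
pose a' : Vd := \row_j if j == i then c else a ord0 j.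
have -> : box a b `&` halfspace i c = box a b'.
  apply/seteqP; split => [x [xab xc] j|x xab].
    rewrite mxE; case: eqP => [->|_]; last exact: xab.
    by have /andP[-> _] := xab i.
  split; last by have := xab i; rewrite mxE eqxx => /andP[].
  move=> j; have := xab j; rewrite mxE; case: eqP => [->|//] /andP[-> xc] /=.
  lra.
have -> : box a b `&` ~` halfspace i c = box a' b.
  apply/seteqP; split => [x [xab /= /negP xc] j|x xab].
    rewrite mxE; case: eqP => [->|_]; last exact: xab.
    by have /andP[_ ->] := xab i; rewrite andbT ltNge.
  split; last first.
    by have := xab i; rewrite mxE eqxx => /andP[cx _]; apply/negP; rewrite -ltNge.
  move=> j; have := xab j; rewrite mxE; case: eqP => [->|//] /andP[cx ->] /=.
  rewrite andbT; lra.
have hb j : a ord0 j <= b' ord0 j by rewrite mxE; case: eqP => [->|_//]; exact: ltW.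
have ha j : a' ord0 j <= b ord0 j by rewrite mxE; case: eqP => [->|_//]; exact: ltW.
apply: le_trans (leeD (box_content_le hb) (box_content_le ha)) _.
rewrite -EFinD lee_fin /boxvol (bigD1 i)//= [X in _ + X <= _](bigD1 i)//=.
rewrite [leRHS](bigD1 i)//= !mxE eqxx.
rewrite (eq_bigr (fun j => b ord0 j - a ord0 j)); last first.
  by move=> j /negPf ji; rewrite mxE ji.
rewrite [X in _ + _ * X <= _](eq_bigr (fun j => b ord0 j - a ord0 j)); last first.
  by move=> j /negPf ji; rewrite mxE ji.
by rewrite -mulrDl (_ : c - a ord0 i + (b ord0 i - c) = b ord0 i - a ord0 i)//; ring.
Qed.

(** Caratheodory's criterion: cutting each set of a cover of [X] by the hyperplane yields covers of
    both parts of [X] at no greater total cost. *)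
Lemma measurable_halfspace i c : measurable (halfspace i c : set (Rd R d)).
Proof.
apply: le_caratheodory_measurable => X.
apply: le_ereal_inf_tmp => _ [F [_ XF] <-].
apply: (@le_trans _ _ (\sum_(k <oo) (box_content (F k `&` halfspace i c) +
                               box_content (F k `&` ~` halfspace i c)))%E).
  rewrite nneseriesD; try by move=> *; exact: box_content_ge0.
  apply: leeD; apply: ereal_inf_lbound => /=.
    exists (fun k => F k `&` halfspace i c) => //; split => // x [Xx xc].
    by have [k _ ?] := XF x Xx; exists k.
  exists (fun k => F k `&` ~` halfspace i c) => //; split => // x [Xx xc].
  by have [k _ ?] := XF x Xx; exists k.
apply: lee_nneseries => [k _ _|k _]; last exact: box_content_halfspace.
by apply: adde_ge0; exact: box_content_ge0.
Qed.

Lemma measurable_box (a b : Vd) : measurable (box a b : set (Rd R d)).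
Proof.
rewrite (_ : box a b = \bigcap_(i in [set: 'I_d])
    (halfspace i (b ord0 i) `\` halfspace i (a ord0 i))); last first.
  apply/seteqP; split => [x xab i _|x xab i].
    have /andP[ax xb] := xab i; split => //=; apply/negP.
    by rewrite -ltNge.
  have [xb /negP] := xab i I; rewrite -ltNge => -> /=; exact: xb.
apply: (@fin_bigcap_measurable _ (Rd R d)) => // i _.
by apply: (@measurableD _ (Rd R d)); exact: measurable_halfspace.
Qed.

Lemma lebesgue_le_content (A : set Vd) : (mu A <= box_content A)%E.
Proof.
apply: ereal_inf_lbound => /=.
exists (fun k => if k == 0%N then (A : set (allsets Vd)) else set0).
  by split => // x Ax; exists 0%N.
rewrite (@nneseries_split _ _ 0 1)/=; last by move=> *; exact: box_content_ge0.
rewrite big_nat1 /= eseries0 ?adde0// => -[|k]//= _ _.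
by rewrite box_content0.
Qed.

Lemma lebesgue_box_le (a b : Vd) : (forall i, a ord0 i <= b ord0 i) ->
  (mu (box a b) <= (boxvol a b)%:E)%E.
Proof. by move=> /box_content_le; exact/le_trans/lebesgue_le_content. Qed.

Definition boxes : set (set Vd) := [set B | exists a b, B = box a b].

Lemma boxes_setI : setI_closed boxes.
Proof.
move=> _ _ [a [b ->]] [a' [b' ->]].
exists (\row_i Num.max (a ord0 i) (a' ord0 i)), (\row_i Num.min (b ord0 i) (b' ord0 i)).
apply/seteqP; split => [x [h h'] i|x h].
  rewrite !mxE gt_max le_min.
  by have /andP[-> ->] := h i; have /andP[-> ->] := h' i.
by split => i; have := h i; rewrite !mxE gt_max le_min => /andP[/andP[? ?] /andP[? ?]];
  apply/andP.
Qed.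

Lemma sigma_boxes_measurable : <<s boxes>> `<=` (@measurable _ (Rd R d)).
Proof.
apply: smallest_sub; first exact: sigma_algebra_measurable.
by move=> _ [a [b ->]]; exact: measurable_box.
Qed.

Lemma outer_cover (A : set Vd) (e : R) : 0 < e -> (mu A < +oo)%E ->
  exists B, [/\ <<s boxes>> B, A `<=` B & (mu B <= mu A + e%:E)%E].
Proof.
move=> e0 Afin.
have Afn : mu A \is a fin_num by rewrite ge0_fin_numE ?outer_measure_ge0.
have [_ [F [_ AF] <-] Fe] := lb_ereal_inf_adherent e0 Afn.
(* A covering set that is neither empty nor a box has content +oo. Finiteness of the sum therefore
   forces every [F k] to be empty or a box, so the union is generated by boxes. *)
have Ffin k : (box_content (F k) < +oo)%E.
  rewrite ltey; apply/eqP => Fk.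
  have : (\sum_(k <oo) box_content (F k) = +oo)%E.
    by apply: (eseries_pinfty _ _ Fk) => // n _; rewrite -ltNye;
      exact: lt_le_trans (box_content_ge0 _).
  by move=> FE; rewrite FE ltNge leey in Fe.
exists (\bigcup_k F k); split => //.
- apply: (@bigcupT_measurable _ (g_sigma_algebraType boxes)) => k.
  have := Ffin k; rewrite /box_content; case: asboolP => [-> _|_ h].
    exact: (@measurable0 _ (g_sigma_algebraType boxes)).
  have /ereal_inf_lt[_ [a [b [_ -> _]]] _] := h.
  by apply: sub_sigma_algebra; exists a, b.
- apply: (@le_trans _ _ (\sum_(k <oo) mu (F k))%E).
    exact: outer_measure_sigma_subadditive.
  apply: le_trans (ltW Fe); apply: lee_nneseries => k *.
    exact: outer_measure_ge0.
  exact: lebesgue_le_content.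
Qed.

(** The hull is the intersection of covers whose excess is at most 1/(n+1). *)
Lemma outer_regular (A : set Vd) : (mu A < +oo)%E ->
  exists B, [/\ <<s boxes>> B, A `<=` B & (mu B <= mu A)%E].
Proof.
move=> Afin.
have H (n : nat) : exists B, [/\ <<s boxes>> B, A `<=` B & (mu B <= mu A + n.+1%:R^-1%:E)%E].
  by apply: outer_cover => //; rewrite invr_gt0 ltr0n.
have [B hB] := choice H; exists (\bigcap_n B n); split.
- apply: (@bigcapT_measurable _ (g_sigma_algebraType boxes)) => n.
  by have [] := hB n.
- by move=> x Ax n _; have [_ + _] := hB n; exact.
- apply/lee_addgt0Pr => e e0.
  have [n _ /(_ n (leqnn _)) /= ne] := near_infty_natSinv_lt (PosNum e0).
  have [_ _ h] := hB n; apply: (@le_trans _ _ (mu (B n))).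
    by apply: le_outer_measure; exact: bigcap_inf.
  by apply: le_trans h _; rewrite leeD2l// lee_fin ltW.
Qed.

Definition cube (c : Vd) (r : R) : set Vd :=
  box (c - const_mx r) (c + const_mx r).

Lemma in_cube (c : Vd) r (x : Vd) :
  cube c r x <-> forall i, c ord0 i - r < x ord0 i <= c ord0 i + r.
Proof. by split => h i; have := h i; rewrite !mxE. Qed.

Lemma cube2_sub (c : Vd) r : 0 <= r -> cube c r `<=` cube c (2 * r).
Proof.
move=> r0 x /in_cube xr; apply/in_cube => i.
by have /andP[? ?] := xr i; apply/andP; split; lra.
Qed.

Lemma cube_finite (c : Vd) r : (mu (cube c r) < +oo)%E.
Proof.
(* The volume bound wants ordered endpoints, hence [|r|] in place of a possibly negative [r]. *)
apply: (@le_lt_trans _ _ (mu (cube c `|r|))).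
  apply: le_outer_measure => x /in_cube xr; apply/in_cube => i.
  have := xr i; have := ler_norm r; lra.
apply: le_lt_trans (lebesgue_box_le _) (ltry _) => i.
rewrite !mxE; have := normr_ge0 r; lra.
Qed.

(** The norm is the sup norm. The conjunct [0 < r] matters for d = 0, where the condition on
    coordinates is empty. *)
Lemma ball_coord (x : Vd) r (y : Vd) :
  ball x r y <-> 0 < r /\ forall i, `|x ord0 i - y ord0 i| < r.
Proof.
split=> [[r0 h]|[r0 h]]; split => // i; first exact: (h ord0 i).
by move=> j; rewrite ord1; exact: h.
Qed.

Definition ratvec (q : {ffun 'I_d -> rat}) : Vd := \row_i ratr (q i).

Lemma rational_cube (x : Vd) (e : R) : 0 < e -> exists q n,
  cube (ratvec q) n.+1%:R^-1 x /\ (cube (ratvec q) (2 * n.+1%:R^-1) `<=` ball x e).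
Proof.
move=> e0.
have cube_small (r : R) : 0 < r -> r < e / 4 -> exists q,
    cube (ratvec q) r x /\ cube (ratvec q) (2 * r) `<=` ball x e.
  move=> r0 re.
  have H i : exists q : rat, `|ratr q - x ord0 i| < r.
    have lt_xx : x ord0 i - r < x ord0 i + r by lra.
    have [q] := rat_in_itvoo lt_xx; rewrite in_itv /= => /andP[? ?]; exists q.
    by rewrite ltr_norml; apply/andP; split; lra.
  have [q hq] := choice H; exists [ffun i => q i]; split.
    apply/in_cube => i; rewrite !mxE ffunE; have := hq i.
    by rewrite ltr_norml => /andP[? ?]; apply/andP; split; lra.
  (* Each coordinate of [y] is within r + 2r of that of [x], and 3r < e because r < e/4. *)
  move=> y /in_cube hy; apply/ball_coord; split => // i.
  have := hy i; have := hq i; rewrite !mxE ffunE ltr_norml => /andP[? ?] /andP[? ?].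
  by rewrite ltr_norml; apply/andP; split; lra.
have e4 : 0 < e / 4 by lra.
have [n _ /(_ n (leqnn _)) /= ne] := near_infty_natSinv_lt (PosNum e4).
have [|q hq] := cube_small n.+1%:R^-1 _ ne; first by rewrite invr_gt0 ltr0n.
by exists q, n.
Qed.

(** Asking for the doubled cube to lie in [O] leaves a margin around the small one, into which the
    supports of test functions may spill. The index set is countable, so null sets found cube by
    cube can be united. *)
Lemma open_cubes (O : set Vd) : open O -> O = \bigcup_(qn in
    [set qn : {ffun 'I_d -> rat} * nat |
      cube (ratvec qn.1) (2 * qn.2.+1%:R^-1) `<=` O])
  cube (ratvec qn.1) qn.2.+1%:R^-1.
Proof.
move=> oO; apply/seteqP; split => [x Ox|x [[q n] /= h /in_cube xq]].
  have /nbhs_ballP[e e0 eO] : nbhs x O by exact: open_nbhs_nbhs.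
  have [q [n [qx qe]]] := rational_cube x e0.
  by exists (q, n) => //=; exact: subset_trans qe eO.
apply: h; apply: cube2_sub; last exact/in_cube.
by rewrite invr_ge0 ler0n.
Qed.

Lemma measurable_open (O : set Vd) : open O -> measurable (O : set (Rd R d)).
Proof.
move=> oO; rewrite (open_cubes oO).
rewrite bigcup_mkcond; apply: (@countable_bigcupT_measurable _ (Rd R d)) => // qn.
by case: ifP => _; [exact: measurable_box|exact: (@measurable0 _ (Rd R d))].
Qed.

Lemma measurable_closed (F : set Vd) : closed F -> measurable (F : set (Rd R d)).
Proof.
move=> cF; rewrite -(setCK F); apply: (@measurableC _ (Rd R d)).
by apply: measurable_open; exact: closed_openC.
Qed.

Lemma measurable_compact (K : set Vd) : compact K -> measurable (K : set (Rd R d)).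
Proof.
move=> cK; apply: measurable_closed; apply: compact_closed cK.
exact: norm_hausdorff.
Qed.

Lemma compact_finite (K : set Vd) : compact K -> (mu K < +oo)%E.
Proof.
move=> /compact_bounded[M [Mr /(_ (M + 1)) KM]].
apply: le_lt_trans (cube_finite 0 (M + 2)).
apply: le_outer_measure => x /KM; rewrite ltrDl => /(_ ltr01) xM.
apply/in_cube => i; rewrite mxE.
have : `|x ord0 i| <= M + 1.
  apply: le_trans xM; rewrite [leRHS]/Num.Def.normr /= mx_normrE.
  by apply: (le_bigmax _ _ (ord0, i)).
by rewrite ler_norml => /andP[? ?]; apply/andP; split; lra.
Qed.

Lemma continuous_on_open_measurable (O : set Vd) (f : Vd -> R) : open O ->
  (forall x, O x -> {for x, continuous f}) -> lmeasurable O f.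
Proof.
move=> oO cf; apply: (measurability _ (RGenOInfty.measurableE R)).
move=> _ [_ [c ->] <-]; rewrite -/(measurable _).
apply: measurable_open; rewrite openE => x [Ox /=].
rewrite in_itv /= andbT => cx.
apply: filterI; first by apply: open_nbhs_nbhs.
have := cf x Ox `]c, +oo[%classic; apply.
apply: open_nbhs_nbhs; split; first exact: interval_open.
by rewrite /= in_itv /= andbT.
Qed.

End lebesgue_space.

(** * Smooth approximations of indicators of boxes *)

Section bump.
Context {R : realType}.
Implicit Types (x y t : R) (k : nat).

(** The flat function exp (-1/x), extended by 0, times x^(-k). The powers make the span of the
    family stable under differentiation. *)
Definition ebump k x : R := if 0 < x then (x^-1) ^+ k * expR (- x^-1) else 0.

Lemma ebump_ge0 k x : 0 <= ebump k x.
Proof.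
rewrite /ebump; case: ifPn => // x0.
by rewrite mulr_ge0// ?expR_ge0// exprn_ge0// invr_ge0 ltW.
Qed.

(** With y = 1/x, exp y >= y^(k+1)/(k+1)! gives y^k exp (-y) <= (k+1)!/y. The linear bound yields
    differentiability at 0. *)
Lemma ebump_le k x : ebump k x <= k.+1`!%:R * `|x|.
Proof.
rewrite /ebump; case: ifPn => [x0|_]; last by rewrite mulr_ge0.
have y0 : 0 < x^-1 by rewrite invr_gt0.
have := expR_ge1Dxn k (ltW y0); set y := x^-1 in y0 *; move=> h.
have f0 : 0 < k.+1`!%:R :> R by rewrite ltr0n fact_gt0.
rewrite expRN ler_pdivrMr ?expR_gt0//.
have : y ^+ k.+1 / k.+1`!%:R <= expR y by apply: le_trans h; rewrite lerDr.
rewrite ler_pdivrMr// => h'.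
have := ler_wpM2l (ltW x0) h'.
rewrite exprS mulrA /y divff ?gt_eqF// mul1r => /le_trans; apply.
by rewrite gtr0_norm// le_eqVlt; apply/orP; left; apply/eqP; ring.
Qed.

Lemma ebump0_le1 x : ebump 0 x <= 1.
Proof.
rewrite /ebump; case: ifPn => // x0.
by rewrite expr0 mul1r -expR0 ler_expR oppr_le0 invr_ge0 ltW.
Qed.

Lemma ebump0_ge x : 0 < x -> 1 - x^-1 <= ebump 0 x.
Proof. by move=> x0; rewrite /ebump x0 expr0 mul1r; exact: expR_ge1Dx. Qed.

Lemma is_derive_ebump k x :
  is_derive x 1 (ebump k) (ebump k.+2 x - k%:R * ebump k.+1 x).
Proof.
have [x0|x0|->] := ltgtP x 0.
- rewrite /ebump !ltNge (ltW x0)/= mulr0 subr0.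
  apply: (@near_eq_is_derive _ _ _ (cst 0)).
  have : \forall y \near x, y < 0 by exact: lt_nbhsl.
  by apply: filterS => y y0; rewrite ltNge (ltW y0).
- have xn0 : x != 0 by rewrite gt_eqF.
  apply: (@near_eq_is_derive _ _ _ (fun y => (y^-1) ^+ k * expR (- y^-1))).
    have : \forall y \near x, 0 < y by exact: lt_nbhsr.
    by apply: filterS => y y0; rewrite /ebump y0.
  have dV : is_derive x 1 (fun y : R => y^-1) (- x ^- 2).
    have := @is_deriveV R id x 1 1 xn0 _.
    by move=> /(_ (is_derive_id _ _)); rewrite scaler1.
  have dX : is_derive x 1 (fun y : R => (y^-1) ^+ k) (k%:R * x^-1 ^+ k.-1 * - x ^- 2).
    rewrite (_ : (fun y : R => _) = (fun y : R => y^-1) ^+ k); last by rewrite exprfctE.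
    exact: (@is_deriveX _ _ (fun y : R => y^-1) k x 1 _ dV).
  have dN : is_derive x 1 (fun y : R => - y^-1) (x ^- 2).
    by have := @is_deriveN _ _ _ (fun y : R => y^-1) x 1 _ dV; rewrite opprK.
  have dE : is_derive x 1 (fun y : R => expR (- y^-1)) (expR (- x^-1) * x ^- 2).
    exact: (@is_derive1_comp _ expR (fun y => - y^-1) x _ _ (is_derive_expR _) dN).
  have dM := @is_deriveM _ _ (fun y : R => (y^-1) ^+ k) (fun y => expR (- y^-1)) x 1 _ _ dX dE.
  apply: (is_derive_eq dM).
  rewrite /ebump x0 /GRing.scale /= -exprVn.
  case: k {dX dM} => [|k] /=; first by rewrite !mul0r ?mulr0; ring.
  rewrite !exprS; ring.
- rewrite {2 3}/ebump ltxx mulr0 subr0.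
  (* At 0 the difference quotient is [ebump k.+1 h] for h > 0 and 0 for h < 0, and [ebump_le] makes
     it O(|h|). *)
  have cvg0 : h^-1 *: (ebump k (h *: (1 : R) + 0) - ebump k 0) @[h --> 0^'] --> (0 : R).
    apply/cvgrPdist_le => /= e e0.
    have F0 : 0 < k.+2`!%:R :> R by rewrite ltr0n fact_gt0.
    near=> h.
    rewrite sub0r normrN [ebump k 0]/ebump ltxx subr0 addr0 /GRing.scale /= mulr1.
    have hE : `|h^-1 * ebump k h| <= ebump k.+1 h.
      rewrite {2}/ebump /ebump; case: ifPn => h0; last by rewrite mulr0 normr0.
      by rewrite exprS -mulrA ger0_norm// mulr_ge0// ?invr_ge0 ?ltW// mulr_gt0// ?exprn_gt0 ?invr_gt0 ?expR_gt0.
    apply: le_trans hE _; apply: le_trans (ebump_le _ _) _.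
    rewrite mulrC -ler_pdivlMr//.
    near: h; apply: dnbhs0_le; exact: divr_gt0.
  apply: DeriveDef; first by apply/cvg_ex; exists 0.
  exact/cvg_lim.
Unshelve. all: by end_near. Qed.

Lemma cvg_ebump0 (u : nat -> R) : u @ \oo --> +oo ->
  ebump 0 (u n) @[n --> \oo] --> (1 : R).
Proof.
move=> uoo; apply/cvgrPdist_le => e e0.
have u0 : \forall n \near \oo, 0 < u n by apply: (cvgry_gt uoo).
have ue : \forall n \near \oo, e^-1 < u n by apply: (cvgry_gt uoo).
apply: filterS2 u0 ue => n n0 ne.
rewrite ger0_norm ?subr_ge0 ?ebump0_le1// lerBlDr addrC -lerBlDr.
apply: le_trans (ebump0_ge n0); rewrite lerD2l lerN2.
by rewrite invf_ple ?posrE// ltW.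
Qed.

End bump.

(** * Test functions built from one-variable bumps *)

Section test_functions.
Context {R : realType} {d : nat}.
Local Notation Vd := 'rV[R]_d.
Implicit Types (O : set Vd) (i : 'I_d) (a b c : Vd).

Lemma is_derive_line (f : Vd -> R) (x e : Vd) (df : R) :
  is_derive (0 : R) (1 : R) (fun h : R => f (h *: e + x)) df -> is_derive x e f df.
Proof.
have E : (fun h : R => h^-1 *: (f ((h *: (1 : R) + 0) *: e + x) - f (0 *: e + x))) =
         (fun h : R => h^-1 *: (f (h *: e + x) - f x)).
  by apply/funext => h; rewrite scale0r add0r addr0 /GRing.scale /= mulr1.
move=> [dh hE]; apply: DeriveDef.
  by move: dh; rewrite /derivable /= E.
by rewrite -hE /derive /= E.
Qed.

(** An algebra of continuous functions that partial derivatives map to itself: this gives smoothness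
    of all orders at once, without formulas for higher derivatives. *)
Inductive bumps : (Vd -> R) -> Prop :=
| bumps_ebump i k (s t : R) : bumps (fun x => ebump k (s * x ord0 i + t))
| bumps_cst t : bumps (cst t)
| bumpsD u w : bumps u -> bumps w -> bumps (u \+ w)
| bumpsM u w : bumps u -> bumps w -> bumps (u \* w).

Lemma bumps_continuous u : bumps u -> continuous u.
Proof.
elim=> [i k s t|t|u1 u2 _ c1 _ c2|u1 u2 _ c1 _ c2] x.
- have ce : {for s * x ord0 i + t, continuous (@ebump R k)}.
    apply/differentiable_continuous/derivable1_diffP.
    by have [] := is_derive_ebump k (s * x ord0 i + t).
  apply: (@continuous_comp _ _ _ (fun x : Vd => s * x ord0 i + t) (ebump k)) => //.
  apply: continuousD; last exact: cst_continuous.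
  by apply: continuousM; [exact: cst_continuous|exact: coord_continuous].
- exact: cst_continuous.
- exact: continuousD (c1 x) (c2 x).
- exact: continuousM (c1 x) (c2 x).
Qed.

Lemma bumps_partial u i : bumps u -> (forall x, derivable u x (evec R i)) /\
  bumps (partial i u).
Proof.
elim=> [j k s t|t|u1 u2 P1 [d1 b1] P2 [d2 b2]|u1 u2 P1 [d1 b1] P2 [d2 b2]].
- pose u' (x : Vd) := ebump k.+2 (s * x ord0 j + t) - k%:R * ebump k.+1 (s * x ord0 j + t).
  have du x : is_derive x (evec R i) (fun x => ebump k (s * x ord0 j + t))
      (u' x * (s * (i == j)%:R)).
    apply: is_derive_line.
    pose L (h : R) := (s * (i == j)%:R) * h + (s * x ord0 j + t).
    rewrite (_ : (fun h => _) = ebump k \o L); last first.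
      apply/funext => h /=; rewrite /L !mxE /= eq_sym; congr ebump; ring.
    have dL : is_derive (0 : R) 1 L (s * (i == j)%:R).
      rewrite /L; apply: is_derive_eq; rewrite /GRing.scale /=; ring.
    have L0 : L 0 = s * x ord0 j + t by rewrite /L mulr0 add0r.
    have := is_derive_ebump k (L 0); rewrite {2 3}L0 => dE.
    exact: (@is_derive1_comp _ (ebump k) L 0 _ _ dE dL).
  split=> [x|]; first by have [] := du x.
  rewrite (_ : partial _ _ = (fun x => ebump k.+2 (s * x ord0 j + t)) \* cst (s * (i == j)%:R) \+
     (fun x => ebump k.+1 (s * x ord0 j + t)) \* cst (- k%:R * (s * (i == j)%:R))); last first.
    apply/funext => x; have [_] := du x; rewrite /partial => ->; rewrite /u' /=; ring.
  by apply: bumpsD; apply: bumpsM; (exact: bumps_ebump || exact: bumps_cst).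
- split=> [x|]; first exact: derivable_cst.
  rewrite (_ : partial _ _ = cst 0); first exact: bumps_cst.
  by apply/funext => x; exact: derive_cst.
- split=> [x|]; first exact: derivableD (d1 x) (d2 x).
  rewrite (_ : partial _ _ = partial i u1 \+ partial i u2); first exact: bumpsD.
  by apply/funext => x; exact: deriveD (d1 x) (d2 x).
- split=> [x|]; first exact: derivableM (d1 x) (d2 x).
  rewrite (_ : partial _ _ = u1 \* partial i u2 \+ u2 \* partial i u1).
    by apply: bumpsD; exact: bumpsM.
  by apply/funext => x; exact: deriveM (d1 x) (d2 x).
Qed.

Lemma bumps_dpart u (m : 'I_d -> nat) : bumps u -> bumps (dpart m u).
Proof.
move=> bu; rewrite /dpart; elim: (enum 'I_d) => //= i s ih.
by elim: (m i) => //= n /(bumps_partial i)[].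
Qed.

Lemma bumps_Ck u k O : bumps u -> Ck k O u.
Proof.
move=> bu m _ x _; split; first exact: (bumps_continuous (bumps_dpart m bu)).
by move=> _ i; have [+ _] := bumps_partial i (bumps_dpart m bu); exact.
Qed.

(* The shift by [n.+1] in the second factor makes the limit the indicator of a
   box that is closed on the right. *)
Definition box_bump a b (n : nat) (x : Vd) : R :=
  \prod_(i < d) (ebump 0 (n.+1%:R * (x ord0 i - a ord0 i)) *
                 ebump 0 (n.+1%:R ^+ 2 * (b ord0 i - x ord0 i) + n.+1%:R)).

Lemma box_bump_bumps a b n : bumps (box_bump a b n).
Proof.
rewrite /box_bump; elim: (index_enum _) => [|i s ih].
  by under eq_fun do rewrite big_nil; exact: bumps_cst.
under eq_fun do rewrite big_cons; apply: bumpsM => //.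
apply: (@bumpsM (fun x : Vd => ebump 0 (n.+1%:R * (x ord0 i - a ord0 i)))
  (fun x : Vd => ebump 0 (n.+1%:R ^+ 2 * (b ord0 i - x ord0 i) + n.+1%:R))).
  under eq_fun do rewrite mulrBr; exact: bumps_ebump.
rewrite (_ : (fun x => _) = (fun x : Vd => ebump 0 (- n.+1%:R ^+ 2 * x ord0 i +
    (n.+1%:R ^+ 2 * b ord0 i + n.+1%:R)))); first exact: bumps_ebump.
by apply/funext => x; congr ebump; ring.
Qed.

Lemma box_bump_ge0 a b n (x : Vd) : 0 <= box_bump a b n x.
Proof. by apply: prodr_ge0 => i _; rewrite mulr_ge0// ebump_ge0. Qed.

Lemma box_bump_le1 a b n (x : Vd) : box_bump a b n x <= 1.
Proof.
apply: prodr_ile1 => i _; rewrite mulr_ge0 ?ebump_ge0//=.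
by rewrite mulr_ile1 ?ebump_ge0 ?ebump0_le1.
Qed.

(** The argument of the second factor is (n+1)^2 (b_i + 1/(n+1) - x_i), so the bump overshoots the
    box by at most 1/(n+1), and only on the right. *)
Lemma box_bump_eq0 a b n (x : Vd) i :
  (x ord0 i <= a ord0 i) || (b ord0 i + n.+1%:R^-1 <= x ord0 i) ->
  box_bump a b n x = 0.
Proof.
move=> h; rewrite /box_bump (bigD1 i)//=.
have N0 : 0 < n.+1%:R :> R by rewrite ltr0n.
suff -> : ebump 0 (n.+1%:R * (x ord0 i - a ord0 i)) *
  ebump 0 (n.+1%:R ^+ 2 * (b ord0 i - x ord0 i) + n.+1%:R) = 0 by rewrite mul0r.
case/orP: h => h; rewrite /ebump.
  by rewrite pmulr_rgt0// subr_gt0 ltNge h mul0r.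
rewrite [X in _ * X]ifN ?mulr0// -leNgt.
have -> : n.+1%:R ^+ 2 * (b ord0 i - x ord0 i) + n.+1%:R =
  n.+1%:R ^+ 2 * (b ord0 i + n.+1%:R^-1 - x ord0 i) :> R.
  by field; rewrite gt_eqF.
by rewrite pmulr_rle0 ?exprn_gt0// subr_le0.
Qed.

Lemma cvg_box_bump a b (x : Vd) : box_bump a b n x @[n --> \oo] --> (\1_(box a b) x : R).
Proof.
have natoo : (n.+1%:R : R) @[n --> \oo] --> +oo.
  by rewrite (cvg_shiftS (fun n => n%:R : R)); exact: cvgr_idn.
rewrite indicE; case: (boolP (x \in box a b)) => [|xB].
  rewrite inE => xab; rewrite /box_bump.
  have -> : (true%:R : R) = \prod_(i < d) 1 by rewrite big1.
  elim: (index_enum _) => [|i s ih].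
    under eq_fun do rewrite big_nil; rewrite big_nil; exact: cvg_cst.
  under eq_fun do rewrite big_cons; rewrite big_cons.
  apply: cvgM => //; rewrite -[X in _ --> X]mulr1.
  have /andP[ax xb] := xab i.
  apply: cvgM; apply: cvg_ebump0.
    apply/cvgryPgt => A.
    have : \forall n \near \oo, A / (x ord0 i - a ord0 i) < n.+1%:R by exact: cvgry_gt.
    by apply: filterS => n; rewrite ltr_pdivrMr// subr_gt0.
  (* On the right face x_i = b_i the quadratic term vanishes, and the shift [n.+1] alone drives the
     argument to +oo. *)
  apply/cvgryPgt => A; have : \forall n \near \oo, A < n.+1%:R by exact: cvgry_gt.
  apply: filterS => n /lt_le_trans; apply; rewrite lerDr mulr_ge0 ?exprn_ge0//.
  by rewrite subr_ge0.
have [i xi] : exists i, ~~ (a ord0 i < x ord0 i <= b ord0 i).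
  apply/existsP; rewrite -negb_forall; apply: contra xB => /forallP h.
  by rewrite inE.
(* Outside the box the sequence is eventually 0: always if x_i <= a_i, and once 1/(n+1) < x_i - b_i
   otherwise. *)
apply: cvg_near_cst.
move: xi; rewrite negb_and -leNgt -ltNge => /orP[xa|bx].
  by apply: nearW => n; apply: (@box_bump_eq0 _ _ _ _ i); rewrite xa.
have bx0 : 0 < x ord0 i - b ord0 i by rewrite subr_gt0.
have := near_infty_natSinv_lt (PosNum bx0); apply: filterS => n /= h.
apply: (@box_bump_eq0 _ _ _ _ i); apply/orP; right.
by rewrite -lerBrDl; exact: ltW.
Qed.

Lemma box_bump_Ccinf O a b n :
  [set x : Vd | forall i, a ord0 i <= x ord0 i <= b ord0 i + n.+1%:R^-1] `<=` O ->
  Ccinf O (box_bump a b n).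
Proof.
set K := [set x : Vd | _] => KO; split; first by move=> k; exact/bumps_Ck/box_bump_bumps.
have cK : compact K.
  have := @rV_compact R d (fun i => `[a ord0 i, b ord0 i + n.+1%:R^-1]%classic)
    (fun i => @segment_compact _ _ _).
  by congr compact; apply/seteqP; split => x h i; have := h i; rewrite /= in_itv.
have clK : closed K by apply: compact_closed cK; exact: norm_hausdorff.
have sK : closure [set x | box_bump a b n x != 0] `<=` K.
  rewrite [X in _ `<=` X](closure_id K).1//; apply: closure_subset => x /= x0 i.
  apply/andP; split; rewrite leNgt; apply: contra x0 => h; apply/eqP.
    by apply: (@box_bump_eq0 _ _ _ _ i); rewrite ltW.
  by apply: (@box_bump_eq0 _ _ _ _ i); rewrite orbC ltW.
split; last exact: subset_trans KO.
exact: subclosed_compact (@closed_closure _ _) cK sK.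
Qed.

End test_functions.

(** * L^p estimates and completeness *)

Section powR_extra.
Context {R : realType}.
Implicit Types (p t : R).

Lemma cvg_norm_powR p (u : nat -> R) (l : R) : 1 <= p ->
  u @ \oo --> l -> (fun n => `|u n| `^ p) @ \oo --> `|l| `^ p.
Proof.
move=> p1 /cvg_norm ul; have p0 : p != 0 by apply/lt0r_neq0; exact: lt_le_trans p1.
(* [powR] is exp (p ln t) only for t != 0. A zero limit is squeezed instead, since |t|^p <= |t| for
   |t| <= 1 and p >= 1. *)
have [l0|l0] := eqVneq `|l| 0.
  rewrite l0 powR0//; rewrite l0 in ul.
  apply: (@squeeze_cvgr _ _ _ _ (cst 0) (fun n => `|u n|)) => //; last exact: cvg_cst.
  move/cvgrPdist_lt : ul => /(_ 1 ltr01); apply: filterS => n.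
  rewrite sub0r normrN normr_id => un; rewrite powR_ge0/=.
  have [->|un0] := eqVneq `|u n| 0; first by rewrite powR0.
  by apply: ge1r_powR => //; rewrite lt_neqAle eq_sym un0 normr_ge0 ltW.
have lp : 0 < `|l| by rewrite lt_neqAle eq_sym l0 normr_ge0.
rewrite /powR (negbTE l0).
apply: (@cvg_trans _ ((fun n => expR (p * ln `|u n|)) @ \oo)).
  apply: near_eq_cvg; move/cvgr_gt : ul => /(_ _ lp).
  by apply: filterS => n un; rewrite gt_eqF.
have lnu : ln `|u n| @[n --> \oo] --> ln `|l| by exact: cvg_comp ul (continuous_ln lp).
apply: (cvg_comp (fun n => p * ln `|u n|) expR _ (@continuous_expR R _)).
by apply: cvgM => //; exact: cvg_cst.
Qed.

Lemma normrD_powR p (s t : R) : 0 <= p ->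
  `|s + t| `^ p <= 2 `^ p * (`|s| `^ p + `|t| `^ p).
Proof.
move=> p0; set M := Num.max `|s| `|t|.
have M0 : 0 <= M by rewrite le_max normr_ge0.
apply: (@le_trans _ _ ((2 * M) `^ p)).
  apply: ge0_ler_powR; rewrite ?nnegrE ?mulr_ge0//.
  apply: le_trans (ler_normD _ _) _.
  by rewrite mulr_natl mulr2n lerD// le_max lexx ?orbT.
rewrite powRM// ler_wpM2l ?powR_ge0//.
by rewrite /M; case: (leP `|s| `|t|) => _; rewrite ?lerDl ?lerDr powR_ge0.
Qed.

Lemma ler_normr_powR p (t : R) : 1 <= p -> `|t| <= 1 + `|t| `^ p.
Proof.
move=> p1; have [t1|/ltW t1] := leP `|t| 1.
  by apply: le_trans t1 _; rewrite lerDl powR_ge0.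
by apply: le_trans (le1r_powR t1 p1) _; rewrite lerDr.
Qed.

(** The inequality |s| <= 1 + |s|^p at s = t/e, multiplied by e. Integrated over a set of finite
    measure, it makes L^1 norms small when p-th moments are small. *)
Lemma ler_eps_powR p (e t : R) : 1 <= p -> 0 < e ->
  `|t| <= e + e * (e^-1) `^ p * `|t| `^ p.
Proof.
move=> p1 e0; have := ler_normr_powR (e^-1 * t) p1.
rewrite normrM gtr0_norm ?invr_gt0// powRM ?invr_ge0 ?(ltW e0)// => h.
have := ler_wpM2l (ltW e0) h.
by rewrite mulrA divff ?gt_eqF// mul1r mulrDr mulr1 mulrA.
Qed.

End powR_extra.

Section Lp_completeness.
Context {R : realType} {dp : measure_display} {T : measurableType dp}.
Variables (mu : {measure set T -> \bar R}) (D : set T) (p : R).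
Hypotheses (mD : measurable D) (p1 : 1 <= p).
Local Open Scope ereal_scope.
Implicit Types (f g : T -> R).

Let p0 : (0 <= p)%R. Proof. exact: le_trans p1. Qed.

Lemma measurable_norm_powR f : measurable_fun D f ->
  measurable_fun D (fun x => (`|f x| `^ p)%:E).
Proof.
move=> mf; apply/measurable_EFinP.
apply: (measurableT_comp (measurable_powR p)).
exact: measurableT_comp.
Qed.

Lemma integral_powRD f g : measurable_fun D f -> measurable_fun D g ->
  \int[mu]_(x in D) (`|f x + g x| `^ p)%:E <=
  (2 `^ p)%:E * (\int[mu]_(x in D) (`|f x| `^ p)%:E +
                 \int[mu]_(x in D) (`|g x| `^ p)%:E).
Proof.
move=> mf mg.
have mfp := measurable_norm_powR mf; have mgp := measurable_norm_powR mg.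
rewrite -ge0_integralD//=; try by move=> *; rewrite lee_fin powR_ge0.
rewrite -ge0_integralZl//=; last 2 first.
- exact: emeasurable_funD.
- by move=> x _; rewrite -EFinD lee_fin addr_ge0// powR_ge0.
apply: ge0_le_integral => //.
- by apply: measurable_norm_powR; exact: measurable_funD.
- by apply: measurable_funeM; exact: emeasurable_funD.
- by move=> x _; rewrite -EFinD -EFinM lee_fin normrD_powR.
Qed.

Lemma integral_powRD_lty f g : measurable_fun D f -> measurable_fun D g ->
  \int[mu]_(x in D) (`|f x| `^ p)%:E < +oo ->
  \int[mu]_(x in D) (`|g x| `^ p)%:E < +oo ->
  \int[mu]_(x in D) (`|f x + g x| `^ p)%:E < +oo.
Proof.
move=> mf mg If Ig; apply: le_lt_trans (integral_powRD mf mg) _.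
by apply: lte_mul_pinfty; rewrite ?lee_fin ?powR_ge0// lte_add_pinfty.
Qed.

Variable F : nat -> T -> R.
Hypotheses (mF : forall n, measurable_fun D (F n))
  (IF : forall n, \int[mu]_(x in D) (`|F n x| `^ p)%:E < +oo)
  (cauchyF : forall e : R, (0 < e)%R -> exists N, forall n k, (N <= n)%N -> (N <= k)%N ->
     \int[mu]_(x in D) (`|F n x - F k x| `^ p)%:E < e%:E).

(** The increments are weighted by q_j = (2^j)^p and chosen with p-th moments below 2^(-j)/q_j. The
    weighted series then has finite integral, hence is finite a.e., and this alone forces geometric
    decay of the increments; Minkowski's inequality is avoided. *)
Lemma Lp_fast_subsequence : exists s : nat -> nat, (forall j, (j <= s j)%N) /\
  {ae mu, forall x, D x -> cvgn (fun j => F (s j) x)}.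
Proof.
pose q j : R := ((2 ^+ j) `^ p)%R.
have q0 j : (0 < q j)%R by rewrite powR_gt0// exprn_gt0.
have /choice[N hN] (j : nat) : exists N, forall n k, (N <= n)%N -> (N <= k)%N ->
    \int[mu]_(x in D) (`|F n x - F k x| `^ p)%:E < ((q j)^-1 * 2^-1 ^+ j)%:E.
  by apply: cauchyF; rewrite mulr_gt0 ?invr_gt0// exprn_gt0.
(* Summing the thresholds makes [s] monotone with [N j <= s j]; the summand [j] gives [j <= s j]. *)
pose s j := (j + \sum_(i < j.+1) N i)%N.
have sN j : (N j <= s j)%N by rewrite /s big_ord_recr/= addnA leq_addl.
have sS j : (s j <= s j.+1)%N.
  by rewrite /s [X in (_ <= _ + X)%N]big_ord_recr/= leq_add// leq_addr.
exists s; split => [j|]; first exact: leq_addr.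
pose dl j x := (F (s j.+1) x - F (s j) x)%R.
have mdl j : measurable_fun D (dl j) by exact: measurable_funB.
pose S x : \bar R := \sum_(j <oo) ((q j)%:E * (`|dl j x| `^ p)%:E).
have mt j : measurable_fun D (fun x => (q j)%:E * (`|dl j x| `^ p)%:E).
  by apply: measurable_funeM; exact: measurable_norm_powR.
have t0 j x : 0 <= (q j)%:E * (`|dl j x| `^ p)%:E.
  by rewrite -EFinM lee_fin mulr_ge0 ?powR_ge0// ltW.
have mS : measurable_fun D S.
  by apply: (@ge0_emeasurable_sum _ _ _ D (fun j x => (q j)%:E * (`|dl j x| `^ p)%:E) xpredT).
have IS : \int[mu]_(x in D) S x < +oo.
  rewrite integral_nneseries//.
  apply: (@le_lt_trans _ _ (\sum_(j <oo) (2^-1 ^+ j : R)%:E)).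
    apply: lee_nneseries => j *; first by apply: integral_ge0.
    have dlp x : D x -> 0 <= (`|dl j x| `^ p)%:E by rewrite lee_fin powR_ge0.
    have qj : 0 <= (q j)%:E by rewrite lee_fin ltW.
    rewrite (ge0_integralZl mu mD (measurable_norm_powR (mdl j)) dlp qj).
    have := hN j (s j.+1) (s j) (leq_trans (sN j) (sS j)) (sN j).
    move=> /ltW /(lee_wpmul2l qj) /le_trans; apply.
    by rewrite -EFinM mulrA divff ?mul1r ?gt_eqF.
  rewrite (_ : \sum_(j <oo) _ = (limn (series (@geometric R 1 2^-1) : R^nat))%:E) ?ltry//.
  rewrite -EFin_lim; last first.
    by apply: is_cvg_geometric_series; rewrite ger0_norm// invf_lt1// ltr1n.
  apply: congr_lim; apply/funext => n /=; rewrite sumEFin /series /=.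
  by congr EFin; apply: eq_bigr => k _; rewrite mul1r.
have : mu.-integrable D S.
  apply/integrableP; split => //.
  rewrite (eq_integral S)// => x _; rewrite gee0_abs//.
  by apply: nneseries_ge0 => *.
move=> /(integrable_ae mD); apply: filterS => x Sx Dx.
pose z := fine (S x).
have Sz : S x = z%:E by rewrite fineK//; exact: Sx.
(* One term of the series is at most its sum z, so |2^j dl|^p <= z and then |2^j dl| <= 1 + z. *)
have dlz j : (`|dl j x| <= (1 + z) * 2^-1 ^+ j)%R.
  have tz : (`|2 ^+ j * dl j x| `^ p <= z)%R.
    rewrite normrM powRM// ger0_norm ?exprn_ge0// -lee_fin -Sz EFinM.
    apply: le_trans (nneseries_lim_ge j.+1 _); last by move=> *.
    by rewrite big_nat_recr//= leeDr// sume_ge0.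
  have := le_trans (ler_normr_powR (2 ^+ j * dl j x) p1) (lerD (lexx 1%R) tz).
  by rewrite normrM ger0_norm ?exprn_ge0// mulrC -ler_pdivlMr ?exprn_gt0// exprVn.
have : cvgn (series (fun j => dl j x)).
  apply: normed_cvg.
  apply: (@series_le_cvg _ _ (geometric (1 + z)%R 2^-1)) => //.
  - by move=> j /=.
  - by move=> j /=; rewrite mulr_ge0// ?exprn_ge0// addr_ge0// -lee_fin -Sz; apply: nneseries_ge0.
  - by apply: is_cvg_geometric_series; rewrite ger0_norm// invf_lt1// ltr1n.
have -> : series (fun j => dl j x) = [sequence F (s n) x - F (s 0%N) x]_n%R.
  exact: (telescopeK (fun j => F (s j) x)).
move=> h; have : cvgn (fun n => (F (s n) x - F (s 0%N) x) + F (s 0%N) x)%R.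
  by apply: is_cvgD => //; exact: is_cvg_cst.
by under eq_fun do rewrite subrK.
Qed.

Lemma Lp_complete : exists h : T -> R, [/\ measurable_fun D h,
  \int[mu]_(x in D) (`|h x| `^ p)%:E < +oo &
  forall e : R, (0 < e)%R -> exists N, forall n, (N <= n)%N ->
    \int[mu]_(x in D) (`|F n x - h x| `^ p)%:E <= e%:E].
Proof.
have [s [sj cvgs]] := Lp_fast_subsequence.
(* The upper limit is measurable on all of [D], also where the subsequence diverges. *)
pose h x := fine (limn_esup (fun j => (F (s j) x)%:E)).
have mh : measurable_fun D h.
  apply: measurableT_comp; first exact: fine_measurable.
  by apply: measurable_fun_limn_esup => n; apply/measurable_EFinP.
have hcvg : {ae mu, forall x, D x -> F (s j) x @[j --> \oo] --> h x}.
  apply: filterS cvgs => x + Dx => /(_ Dx) Fx.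
  have : (F (s j) x)%:E @[j --> \oo] --> (limn (fun j => F (s j) x))%:E.
    by apply: cvg_EFin => //; exact: nearW.
  by move=> /cvg_limn_einf_sup[_ hE]; rewrite /h hE.
have hF (e : R) : (0 < e)%R -> exists N, forall n, (N <= n)%N ->
    \int[mu]_(x in D) (`|F n x - h x| `^ p)%:E <= e%:E.
  move=> e0; have [N hN] := cauchyF e0; exists N => n Nn.
  have mFs j : measurable_fun D (fun x => (`|F n x - F (s j) x| `^ p)%:E).
    by apply: measurable_norm_powR; exact: measurable_funB.
  (* For fixed [n], |F n - h|^p is a.e. the lower limit of |F n - F (s j)|^p, so Fatou's lemma
     transfers the Cauchy bound to [h]. *)
  rewrite (@ae_eq_integral _ _ _ _ _
      (fun x => limn_einf (fun j => (`|F n x - F (s j) x| `^ p)%:E)))//.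
  - apply: le_trans (fatou mu mD mFs _) _ => [*|].
      by rewrite lee_fin powR_ge0.
    rewrite limn_einf_lim; apply: lime_le; first exact: is_cvg_einfs.
    (* Index k + N lies in the k-th tail and satisfies N <= s (k + N), so the Cauchy bound applies
       to it. *)
    apply: nearW => k; apply: (@le_trans _ _
        (\int[mu]_(x in D) (`|F n x - F (s (k + N)%N) x| `^ p)%:E)).
      by apply: ereal_inf_lbound; exists (k + N)%N => //=; exact: leq_addr.
    by apply/ltW/hN => //; exact: leq_trans (leq_addl _ _) (sj _).
  - by apply: measurable_norm_powR; exact: measurable_funB.
  - under eq_fun do rewrite -[limn_einf _]oppeK -limn_esupN.
    apply: measurableT_comp => //; apply: measurable_fun_limn_esup => j.
    exact: measurableT_comp.
  apply: filterS hcvg => x + Dx => /(_ Dx) Fx.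
  have : (`|F n x - F (s j) x| `^ p)%:E @[j --> \oo] --> (`|F n x - h x| `^ p)%:E.
    apply: cvg_EFin; first exact: nearW.
    by apply: cvg_norm_powR => //; apply: cvgB => //; exact: cvg_cst.
  by move=> /cvg_limn_einf_sup[-> _].
exists h; split => //.
have [N /(_ N (leqnn _)) hN] := hF 1%R ltr01.
rewrite (eq_integral (fun x => (`|F N x + (h x - F N x)| `^ p)%:E)); last first.
  by move=> x _; rewrite addrC subrK.
apply: integral_powRD_lty => //; first exact: measurable_funB.
under eq_integral do rewrite distrC.
exact: le_lt_trans hN (ltry _).
Qed.

End Lp_completeness.

(** * Comparison of weighted integrals *)

Section weighted_integrals.
Context {R : realType} {dp : measure_display} {T : measurableType dp}.
Variable mu : {measure set T -> \bar R}.
Local Open Scope ereal_scope.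
Implicit Types (f g w G : T -> R) (K D : set T).

Lemma measurable_normM K f g : measurable_fun K f -> measurable_fun K g ->
  measurable_fun K (fun x => (`|f x * g x|)%:E).
Proof.
move=> mf mg; apply/measurable_EFinP; apply: measurableT_comp => //.
exact: measurable_funM.
Qed.

Lemma weight_le K (C : R) f w G : measurable K -> (0 <= C)%R ->
  measurable_fun K f -> measurable_fun K w -> measurable_fun K G ->
  {ae mu, forall x, K x -> (`|G x| <= C * `|w x|)%R} ->
  \int[mu]_(x in K) (`|f x * G x|)%:E <= C%:E * \int[mu]_(x in K) (`|f x * w x|)%:E.
Proof.
move=> mK C0 mf mw mG GC.
have mfG := measurable_normM mf mG; have mfw := measurable_normM mf mw.
rewrite -ge0_integralZl//; apply: (ae_ge0_le_integral mK) => //.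
- by move=> x _; rewrite -EFinM lee_fin mulr_ge0.
- exact: measurable_funeM.
apply: filterS GC => x Gx /Gx {}Gx; rewrite -EFinM lee_fin !normrM.
by rewrite mulrCA ler_wpM2l.
Qed.

Lemma integral_normB_lty K f g w : measurable K ->
  measurable_fun K f -> measurable_fun K g -> measurable_fun K w ->
  \int[mu]_(x in K) (`|f x * w x|)%:E < +oo ->
  \int[mu]_(x in K) (`|g x * w x|)%:E < +oo ->
  \int[mu]_(x in K) (`|(f \- g)%R x * w x|)%:E < +oo.
Proof.
move=> mK mf mg mw fw gw.
have mfw := measurable_normM mf mw; have mgw := measurable_normM mg mw.
apply: (@le_lt_trans _ _ (\int[mu]_(x in K) ((`|f x * w x|)%:E + (`|g x * w x|)%:E))).
  apply: ge0_le_integral => //.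
  - by apply: measurable_normM => //; exact: measurable_funB.
  - exact: emeasurable_funD.
  - by move=> x _; rewrite -EFinD lee_fin /= mulrBl ler_normB.
by rewrite ge0_integralD//; exact: lte_add_pinfty.
Qed.

Lemma integral_norm_le_powR_subset K D (p e : R) f :
  measurable K -> measurable D -> K `<=` D ->
  (1 <= p)%R -> (0 < e)%R -> measurable_fun D f ->
  \int[mu]_(x in K) (`|f x|)%:E <= e%:E * mu K +
    (e * e^-1 `^ p)%:E * \int[mu]_(x in D) (`|f x| `^ p)%:E.
Proof.
move=> mK mD KD p1 e0 mf.
have mfp := measurable_norm_powR p mf.
have mfK : measurable_fun K f by exact: measurable_funS mf.
have mfpK : measurable_fun K (fun x => (`|f x| `^ p)%:E) by exact: measurable_funS mfp.
have ep : (0 <= e * e^-1 `^ p)%R by rewrite mulr_ge0 ?powR_ge0// ltW.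
apply: (@le_trans _ _ (\int[mu]_(x in K) (e%:E + (e * e^-1 `^ p)%:E * (`|f x| `^ p)%:E))).
  apply: ge0_le_integral => //.
  - by apply/measurable_EFinP; exact: measurableT_comp.
  - by apply: emeasurable_funD => //; exact: measurable_funeM.
  - by move=> x _; rewrite -EFinM -EFinD lee_fin; exact: ler_eps_powR.
rewrite ge0_integralD//; last 3 first.
- by move=> x _; rewrite lee_fin ltW.
- by move=> x _; rewrite -EFinM lee_fin mulr_ge0// powR_ge0.
- exact: measurable_funeM.
rewrite integral_cst// leeD2l// ge0_integralZl//.
apply: lee_wpmul2l; rewrite ?lee_fin//.
by apply: ge0_subset_integral => // x _; rewrite lee_fin powR_ge0.
Qed.

Lemma integral_powR_ae D p f g : measurable D ->
  measurable_fun D f -> measurable_fun D g -> {ae mu, forall x, D x -> f x = g x} ->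
  \int[mu]_(x in D) (`|f x| `^ p)%:E = \int[mu]_(x in D) (`|g x| `^ p)%:E.
Proof.
move=> mD mf mg fg; apply: ge0_ae_eq_integral => //.
- exact: measurable_norm_powR.
- exact: measurable_norm_powR.
by apply: filterS fg => x fgx /fgx ->.
Qed.

End weighted_integrals.

(** * The Leibniz structure of iterated partial derivatives *)

Section leibniz.
Context {R : realType} {d : nat}.
Local Notation Vd := 'rV[R]_d.
Implicit Types (O : set Vd) (f g : Vd -> R) (a b : 'I_d -> nat).

Lemma foldr_partial0 a f (s : seq 'I_d) : (forall j, j \in s -> a j = 0%N) ->
  foldr (fun i g => iter (a i) (partial i) g) f s = f.
Proof.
elim: s => //= j s ih h; rewrite h ?mem_head// ih// => k ks.
by apply: h; rewrite in_cons ks orbT.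
Qed.

Lemma eq_foldr_partial a b f (s : seq 'I_d) : {in s, a =1 b} ->
  foldr (fun i g => iter (a i) (partial i) g) f s =
  foldr (fun i g => iter (b i) (partial i) g) f s.
Proof.
elim: s => //= j s ih h; rewrite h ?mem_head// ih// => k ks.
by apply: h; rewrite in_cons ks orbT.
Qed.

Lemma drop_enum_ord (i : 'I_d) :
  drop i (enum 'I_d) = i :: drop i.+1 (enum 'I_d).
Proof.
by rewrite (drop_nth i) ?size_enum_ord// nth_ord_enum.
Qed.

Lemma mem_take_enum_ord (n : nat) (j : 'I_d) :
  j \in take n (enum 'I_d) -> (j < n)%N.
Proof.
have [nd|dn] := leqP n d; last by move=> _; exact: ltn_trans (ltn_ord j) dn.
move=> /(nthP j)[k]; rewrite size_takel ?size_enum_ord// => kn.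
rewrite nth_take// => <-; rewrite nth_enum_ord//; exact: leq_trans kn nd.
Qed.

Lemma mem_drop_enum_ord (n : nat) (j : 'I_d) :
  j \in drop n (enum 'I_d) -> (n <= j)%N.
Proof.
move=> /(nthP j)[k]; rewrite size_drop size_enum_ord => kn.
by rewrite nth_drop => <-; rewrite nth_enum_ord ?leq_addr// -ltn_subRL.
Qed.

Definition incr a (i : 'I_d) : 'I_d -> nat := fun j => (a j + (j == i))%N.

Lemma mlen_incr a i : mlen (incr a i) = (mlen a).+1.
Proof.
rewrite /mlen /incr big_split /= [X in (_ + X)%N](_ : _ = 1%N) ?addn1//.
by rewrite (bigD1 i)//= eqxx big1// => j /negPf ->.
Qed.

(* The fixed order in which [dpart] takes partial derivatives makes
   differentiation in direction [i] stay inside the family [dpart b f] as long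
   as [b] only involves directions [>= i]; no symmetry of second derivatives is
   needed. *)
Lemma partial_dpart a (i : 'I_d) f : (forall j : 'I_d, (j < i)%N -> a j = 0%N) ->
  partial i (dpart a f) = dpart (incr a i) f.
Proof.
move=> ai; rewrite /dpart -(cat_take_drop i (enum 'I_d)) !foldr_cat.
rewrite drop_enum_ord /= foldr_partial0; last first.
  by move=> j /mem_take_enum_ord; exact: ai.
rewrite [RHS]foldr_partial0; last first.
  move=> j /mem_take_enum_ord ji; rewrite /incr ai// add0n.
  by case: eqP => // je; rewrite je ltnn in ji.
rewrite /incr eqxx addn1 iterS; congr (partial i (iter _ _ _)).
apply: eq_foldr_partial => j /mem_drop_enum_ord ij.
by case: eqP => [je|]; rewrite ?addn0//; rewrite je ltnn in ij.
Qed.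

Lemma dpart0 a f : mlen a = 0%N -> dpart a f = f.
Proof.
move=> /eqP; rewrite sum_nat_eq0 => /forallP h.
by apply: foldr_partial0 => j _; have /eqP := h j.
Qed.

Lemma mlen_alpha0 : mlen (@alpha0 d) = 0%N.
Proof. by rewrite /mlen big1. Qed.

Lemma mlen_eq0 a : mlen a = 0%N -> a = @alpha0 d.
Proof.
move=> /eqP; rewrite sum_nat_eq0 => /forallP h.
by apply/funext => j; have /eqP := h j.
Qed.

Lemma dpart_alpha0 f : dpart (@alpha0 d) f = f.
Proof. by rewrite dpart0// mlen_alpha0. Qed.

Lemma Ck_continuous k O f : Ck k O f -> forall x, O x -> {for x, continuous f}.
Proof.
by move=> h x Ox; have [|+ _] := h (@alpha0 d) _ x Ox; rewrite ?dpart_alpha0 ?mlen_alpha0.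
Qed.

Lemma partial_eq_on O f g i : open O -> (forall x, O x -> f x = g x) ->
  forall x, O x -> partial i f x = partial i g x.
Proof.
move=> oO fg x Ox; apply: near_eq_derive.
by apply: filterS (open_nbhs_nbhs (conj oO Ox)) => y; exact: fg.
Qed.

Lemma dpart_eq_on O f g a : open O -> (forall x, O x -> f x = g x) ->
  forall x, O x -> dpart a f x = dpart a g x.
Proof.
move=> oO fg; rewrite /dpart; elim: (enum 'I_d) => //= i s ih.
by elim: (a i) => //= n; exact: partial_eq_on.
Qed.

Lemma dpart_cst0 a (x : Vd) : dpart a (cst 0) x = 0 :> R.
Proof.
rewrite /dpart (_ : foldr _ _ _ = cst 0)//; elim: (enum 'I_d) => //= i s ->.
by elim: (a i) => //= n ->; apply/funext => y; exact: derive_cst.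
Qed.

(** The algebra of cofactors in the Leibniz expansion, so that no explicit formula has to be
    written. The bound [t] on directions makes [partial_dpart] applicable in direction [t]; the
    bound [n] on the order keeps every derivative within C^m. *)
Inductive dpoly f g (t n : nat) : (Vd -> R) -> Prop :=
| dpoly_l b : (forall j : 'I_d, (j < t)%N -> b j = 0%N) -> (mlen b <= n)%N ->
    dpoly f g t n (dpart b f)
| dpoly_r b : (forall j : 'I_d, (j < t)%N -> b j = 0%N) -> (mlen b <= n)%N ->
    dpoly f g t n (dpart b g)
| dpoly_cst c : dpoly f g t n (cst c)
| dpolyD u w : dpoly f g t n u -> dpoly f g t n w -> dpoly f g t n (u \+ w)
| dpolyM u w : dpoly f g t n u -> dpoly f g t n w -> dpoly f g t n (u \* w).

Lemma dpoly_le f g t t' n n' u : (t' <= t)%N -> (n <= n')%N ->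
  dpoly f g t n u -> dpoly f g t' n' u.
Proof.
move=> tt nn; elim=> [b bt bn|b bt bn|c|? ? _ ? _ ?|? ? _ ? _ ?].
- apply: dpoly_l => [j jt|]; last exact: leq_trans nn.
  by apply: bt; exact: leq_trans tt.
- apply: dpoly_r => [j jt|]; last exact: leq_trans nn.
  by apply: bt; exact: leq_trans tt.
- exact: dpoly_cst.
- exact: dpolyD.
- exact: dpolyM.
Qed.

Lemma dpoly_continuous m O f g t n u : Ck m O f -> Ck m O g -> (n <= m)%N ->
  dpoly f g t n u -> forall x, O x -> {for x, continuous u}.
Proof.
move=> Cf Cg nm; elim=> [b bt bn x Ox|b bt bn x Ox|c x _|u1 u2 _ h1 _ h2 x Ox|u1 u2 _ h1 _ h2 x Ox].
- by have [] := Cf b (leq_trans bn nm) x Ox.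
- by have [] := Cg b (leq_trans bn nm) x Ox.
- exact: cst_continuous.
- exact: continuousD (h1 x Ox) (h2 x Ox).
- exact: continuousM (h1 x Ox) (h2 x Ox).
Qed.

Lemma dpoly_partial m O f g (i : 'I_d) n u :
  Ck m O f -> Ck m O g -> (n < m)%N -> dpoly f g i n u ->
  (forall x, O x -> derivable u x (evec R i)) /\
  exists2 u', dpoly f g i n.+1 u' & forall x, O x -> partial i u x = u' x.
Proof.
move=> Cf Cg nm; elim=> [b bt bn|b bt bn|c|u1 u2 P1 [d1 [v1 V1 E1]] P2 [d2 [v2 V2 E2]]|
  u1 u2 P1 [d1 [v1 V1 E1]] P2 [d2 [v2 V2 E2]]].
- have bm : (mlen b < m)%N by exact: leq_ltn_trans bn nm.
  split=> [x Ox|]; first by have [_] := Cf b (ltnW bm) x Ox; exact.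
  exists (dpart (incr b i) f); last by rewrite partial_dpart.
  apply: dpoly_l; rewrite ?mlen_incr// => j ji; rewrite /incr bt//.
  by case: eqP ji => // ->; rewrite ltnn.
- have bm : (mlen b < m)%N by exact: leq_ltn_trans bn nm.
  split=> [x Ox|]; first by have [_] := Cg b (ltnW bm) x Ox; exact.
  exists (dpart (incr b i) g); last by rewrite partial_dpart.
  apply: dpoly_r; rewrite ?mlen_incr// => j ji; rewrite /incr bt//.
  by case: eqP ji => // ->; rewrite ltnn.
- split=> [x _|]; first exact: derivable_cst.
  by exists (cst 0) => [|x _]; [exact: dpoly_cst|exact: derive_cst].
- split=> [x Ox|]; first by apply: derivableD; [exact: d1|exact: d2].
  exists (v1 \+ v2) => [|x Ox]; first exact: dpolyD.
  by rewrite /= -E1// -E2//; apply: deriveD; [exact: d1|exact: d2].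
- split=> [x Ox|]; first by apply: derivableM; [exact: d1|exact: d2].
  exists ((u1 \* v2) \+ (u2 \* v1)) => [|x Ox].
    by apply: dpolyD; apply: dpolyM => //; apply: dpoly_le (leqnn _) (leqnSn n) _.
  rewrite /= -E1// -E2//; apply: deriveM; [exact: d1|exact: d2].
Qed.

(** The derivative of f^(l+1) u is f^l ((l+1) f' u + f u'): one factor is spent, and the rest is
    again a cofactor. *)
Lemma partial_expM m O f g (i : 'I_d) n l G u : open O ->
  Ck m O f -> Ck m O g -> (n < m)%N -> dpoly f g i n u ->
  (forall x, O x -> G x = f x ^+ l.+1 * u x) ->
  exists2 u', dpoly f g i n.+1 u' &
    forall x, O x -> partial i G x = f x ^+ l * u' x.
Proof.
move=> oO Cf Cg nm Pu GE.
have [du [u' Pu' uE]] := dpoly_partial Cf Cg nm Pu.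
have Pf : dpoly f g i n f.
  by rewrite -{2}(dpart_alpha0 f); apply: dpoly_l; rewrite ?mlen_alpha0.
have [df [f' Pf' fE]] := dpoly_partial Cf Cg nm Pf.
exists (((cst l.+1%:R) \* (f' \* u)) \+ (f \* u')).
  have up := @dpoly_le f g i i n n.+1 _ (leqnn _) (leqnSn n).
  by do ![apply: dpolyD|apply: dpolyM|apply: dpoly_cst] => //; exact: up.
move=> x Ox; rewrite (partial_eq_on i oO GE Ox) /partial.
have dfx := df x Ox; have dux := du x Ox.
rewrite (_ : (fun x => _) = (f ^+ l.+1) * u); last first.
  by apply/funext => y; rewrite /GRing.mul /= fctE.
have dF : derivable (f ^+ l.+1) x (evec R i) := derivableX dfx.
rewrite (deriveM dF dux) (deriveX _ dfx).
rewrite -/(partial i u x) -/(partial i f x) uE// fE// !fctE /=.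
rewrite /GRing.scale /= exprS -mulr_natl.
ring.
Qed.

Lemma dpart_expM m O f g a : open O -> Ck m O f -> Ck m O g -> (mlen a <= m)%N ->
  exists2 u, (forall x, O x -> {for x, continuous u}) &
    forall x, O x -> dpart a (fun y => f y ^+ (mlen a).+1 * g y) x = f x * u x.
Proof.
move=> oO Cf Cg am; pose k := mlen a.
(* [dpart] applies the last directions first, so [N t] counts the derivatives already taken when
   directions [t] and later are done. *)
pose N t := (\sum_(j <- drop t (enum 'I_d)) a j)%N.
have N0 : N 0%N = mlen a by rewrite /N drop0 /mlen big_enum.
have NS (i : 'I_d) : N i = (a i + N i.+1)%N.
  by rewrite /N drop_enum_ord big_cons.
have Nle t : (N t <= k)%N.
  rewrite /k -N0 /N drop0 -[X in (_ <= \sum_(j <- X) _)%N](cat_take_drop t).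
  by rewrite big_cat leq_addl.
(* Downward induction on the direction d - t: the exponent falls from k+1, with no derivative taken,
   to k+1-k = 1. *)
have H t : (t <= d)%N -> exists2 u, dpoly f g (d - t) (N (d - t)%N) u & forall x, O x ->
    foldr (fun i g => iter (a i) (partial i) g) (fun y => f y ^+ k.+1 * g y)
      (drop (d - t) (enum 'I_d)) x = f x ^+ (k.+1 - N (d - t)%N) * u x.
  elim: t => [_|t ih td].
    exists g; last first.
      by move=> x Ox; rewrite /N subn0 drop_oversize ?size_enum_ord//= big_nil.
    by rewrite -{2}(dpart_alpha0 g); apply: dpoly_r; rewrite ?mlen_alpha0.
  have [u Pu uE] := ih (ltnW td).
  have it : (d - t.+1 < d)%N by rewrite ltn_subrL (leq_ltn_trans _ td).
  pose i := Ordinal it.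
  have iS : (d - t = i.+1)%N by rewrite /= subnSK.
  have foldE h z s : foldr h z (i :: s) = h i (foldr h z s) :> (Vd -> R) by [].
  rewrite -[(d - t.+1)%N]/(nat_of_ord i) NS drop_enum_ord foldE; cbv beta.
  rewrite iS in Pu uE.
  (* Inner induction over the [a i] derivatives in direction [i]; [r + N i.+1 <= k] keeps the
     exponent positive. *)
  have := Nle i; rewrite NS; elim: (a i) => [_|r ihr rk].
    rewrite add0n; exists u => //.
    exact: dpoly_le (leqnSn _) (leqnn _) Pu.
  have rk' : (r + N i.+1 <= k)%N by exact: leq_trans (leqnSn _) rk.
  have [u1 Pu1 u1E] := ihr rk'.
  have u1E' x : O x -> iter r (partial i) (foldr (fun i g => iter (a i) (partial i) g)
      (fun y => f y ^+ k.+1 * g y) (drop i.+1 (enum 'I_d))) x =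
      f x ^+ (k - (r + N i.+1)).+1 * u1 x.
    by move=> Ox; rewrite u1E// subSn.
  have rm : (r + N i.+1 < m)%N by exact: leq_trans rk am.
  have [u2 Pu2 u2E] := partial_expM oO Cf Cg rm Pu1 u1E'.
  by exists u2 => // x Ox; rewrite u2E// addSn subSS.
have [u Pu uE] := H d (leqnn _); rewrite subnn N0 drop0 in Pu uE.
exists u; first exact: dpoly_continuous Cf Cg am Pu.
by move=> x Ox; rewrite /dpart -/k uE// -/k subSnn expr1.
Qed.

End leibniz.

(** * The fundamental lemma of the calculus of variations *)

Section density.
Local Open Scope ereal_scope.
Context {R : realType} {dp : measure_display} {T : measurableType dp}.
Variables (mu : {measure set T -> \bar R}) (g : T -> \bar R).
Hypotheses (mg : measurable_fun setT g) (g0 : forall x, 0 <= g x).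

(* The two proofs are arguments so that the measure instance can depend on them. *)
Definition density_of (_ : measurable_fun setT g) (_ : forall x, 0 <= g x)
  (A : set T) : \bar R := \int[mu]_(x in A) g x.

Let density0 : density_of mg g0 set0 = 0.
Proof. exact: integral_set0. Qed.

Let density_ge0 A : 0 <= density_of mg g0 A.
Proof. exact: integral_ge0. Qed.

Let density_sigma_additive : semi_sigma_additive (density_of mg g0).
Proof.
move=> F mF tF mUF; rewrite /density_of ge0_integral_bigcup//.
  by apply: is_cvg_nneseries => *; exact: integral_ge0.
exact: measurable_funTS.
Qed.

HB.instance Definition _ := isMeasure.Build _ _ _ (density_of mg g0)
  density0 density_ge0 density_sigma_additive.

End density.

Section fundamental_lemma.
Context {R : realType} {d : nat}.
Local Notation Vd := 'rV[R]_d.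
Local Notation mu := (lebesgue_d R d).
Implicit Types (f h : Vd -> R) (O K : set Vd).
Local Open Scope ereal_scope.

Lemma bigcup_cube0 : \bigcup_k (cube (0 : Vd) k%:R) = setT.
Proof.
rewrite -subTset => x _.
exists (Num.truncn `|x|).+1 => //; apply/in_cube => i; rewrite mxE.
have : (`|x ord0 i| < (Num.truncn `|x|).+1%:R)%R.
  apply: le_lt_trans (truncnS_gt _); rewrite [leRHS]/Num.Def.normr /= mx_normrE.
  exact: (le_bigmax _ (fun ij => `|x ij.1 ij.2|%R) (ord0, i)).
by rewrite ltr_norml !add0r => /andP[-> /ltW ->].
Qed.

(** The positive and negative parts of [f] are densities of two finite measures that agree on boxes.
    Boxes are stable under intersection and exhaust the space, so the measures agree on the
    generated sigma-algebra. *)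
Lemma sigma_boxes_integral0 f : mu.-integrable setT (EFin \o f) ->
  (forall a b, \int[mu]_(x in box a b) (f x)%:E = 0) ->
  forall A, <<s boxes>> A -> \int[mu]_(x in A) (f x)%:E = 0.
Proof.
move=> intf f0 A sA.
have [mf _] := integrableP _ _ _ intf.
pose F : Rd R d -> \bar R := EFin \o f.
have mp : measurable_fun setT (F^\+ : Rd R d -> \bar R) by exact: measurable_funepos.
have mn : measurable_fun setT (F^\- : Rd R d -> \bar R) by exact: measurable_funeneg.
pose m1 : {measure set (Rd R d) -> \bar R} := density_of mu mp (funepos_ge0 _).
pose m2 : {measure set (Rd R d) -> \bar R} := density_of mu mn (funeneg_ge0 _).
have fin1 B : measurable (B : set (Rd R d)) -> m1 B < +oo.
  move=> mB; apply: integrable_lty => //; apply: integrableS (integrable_funepos _ intf) => //.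
have fin2 B : measurable (B : set (Rd R d)) -> m2 B < +oo.
  move=> mB; apply: integrable_lty => //; apply: integrableS (integrable_funeneg _ intf) => //.
have m12 : m1 A = m2 A.
  apply: (@g_sigma_algebra_measure_unique _ R (Rd R d) boxes _ (fun k => cube (0 : Vd) k%:R) _ _ m1 m2) => //.
  - by move=> _ [a [b ->]]; exact: measurable_box.
  - by move=> k; exists (0 - const_mx k%:R : Vd)%R, (0 + const_mx k%:R : Vd)%R.
  - exact: bigcup_cube0.
  - exact: boxes_setI.
  - move=> _ [a [b ->]]; have := f0 a b; rewrite integralE.
    have m1fin : m1 (box a b) \is a fin_num.
      by rewrite ge0_fin_numE ?fin1//; exact: measurable_box.
    have m2fin : m2 (box a b) \is a fin_num.
      by rewrite ge0_fin_numE ?fin2//; exact: measurable_box.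
    by move/eqP; rewrite sube_eq ?fin_num_adde_defl// add0e => /eqP.
  - by move=> k; apply: fin1; exact: measurable_box.
have pn : \int[mu]_(x in A) F^\+ x = \int[mu]_(x in A) F^\- x := m12.
rewrite integralE [X in X - _]pn subee// ge0_fin_numE; last exact: integral_ge0.
by apply: (fin2 A); exact: sigma_boxes_measurable.
Qed.

(** The part of {f > 0} in a cube has a hull of equal measure in the sigma-algebra of boxes. The
    integral of [f] over it equals that over the hull, namely 0, although [f] is positive there; so
    it is a null set. *)
Lemma null_of_sigma_boxes f : mu.-integrable setT (EFin \o f) ->
  (forall A, <<s boxes>> A -> \int[mu]_(x in A) (f x)%:E = 0) ->
  {ae mu, forall x, (f x <= 0)%R}.
Proof.
move=> intf f0; have [/measurable_EFinP mf _] := integrableP _ _ _ intf.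
pose P : set (Rd R d) := [set x | (0 < f x)%R].
have mP : measurable P.
  have := mf measurableT `]0%R, +oo[%classic (measurable_itv _).
  by rewrite setTI (_ : _ @^-1` _ = P)//; apply/seteqP; split => x /=; rewrite in_itv /= andbT.
suff nP k : mu.-negligible (P `&` cube 0 k%:R).
  have : mu.-negligible (\bigcup_k (P `&` cube 0 k%:R)) by exact: negligible_bigcup.
  rewrite -setI_bigcupr bigcup_cube0 setIT; apply: negligibleS => x /= /negP.
  by rewrite -ltNge.
set A := P `&` _.
have mA : measurable A by apply: measurableI => //; exact: measurable_box.
have Afin : mu A < +oo.
  apply: le_lt_trans (cube_finite (0 : Vd) k%:R).
  by apply: (@le_outer_measure _ _ (lebesgue_outer_om R d)); exact: subIsetr.
have [B [sB AB BA]] := outer_regular Afin.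
have mB := sigma_boxes_measurable sB.
have muBA : mu B = mu A.
  apply/eqP; rewrite eq_le BA.
  exact: (@le_outer_measure _ _ (lebesgue_outer_om R d)).
have nBA : mu (B `\` A) = 0.
  transitivity (mu B - mu A); last by rewrite muBA subee// ge0_fin_numE.
  rewrite measureD//; last exact: le_lt_trans BA Afin.
  by rewrite setIidr.
have A0 : \int[mu]_(x in A) (f x)%:E = 0.
  rewrite -(f0 _ sB) [RHS](@negligible_integral _ _ _ mu B (B `\` A))//.
  - by rewrite setDD setIidr.
  - exact: measurableD.
  - exact: integrableS intf.
have mfA : measurable_fun A (EFin \o f).
  by apply/measurable_EFinP; exact: measurable_funTS.
have : ae_eq mu A (EFin \o f) (cst 0).
  apply/(ae_eq_integral_abs mu mA mfA); rewrite -[RHS]A0; apply: eq_integral => x.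
  by rewrite inE => -[Px _] /=; rewrite gtr0_norm.
move=> [N [mN N0 AN]]; exists N; split => // x Ax; apply: AN => /= /(_ Ax) [fx].
by case: Ax; rewrite /P /= fx ltxx.
Qed.

Lemma ae0_of_boxes f : mu.-integrable setT (EFin \o f) ->
  (forall a b, \int[mu]_(x in box a b) (f x)%:E = 0) ->
  {ae mu, forall x, f x = 0%R}.
Proof.
move=> intf f0; have s0 := sigma_boxes_integral0 intf f0.
have h1 := null_of_sigma_boxes intf s0.
have h2 : {ae mu, forall x, (- f x <= 0)%R}.
  apply: null_of_sigma_boxes => [|A sA].
    exact: integrableN intf.
  rewrite (_ : (fun x => _) = (fun x => - (f x)%:E)); last by apply/funext => x; rewrite EFinN.
  have mA := sigma_boxes_measurable sA.
  rewrite integralN ?s0 ?oppe0//; apply: integrable_add_def => //.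
  exact: (integrableS measurableT mA (@subsetT _ _) intf).
by apply: (@filterS2 _ _ (ae_filter_ringOfSetsType mu) _ _ _ _ h1 h2) => x f1 f2; apply/eqP; rewrite eq_le f1 -oppr_le0.
Qed.

Lemma sub_cube_box (a b c : Vd) r : box a b !=set0 -> box a b `<=` cube c r ->
  forall i, (c ord0 i - r <= a ord0 i)%R && (b ord0 i <= c ord0 i + r)%R.
Proof.
move=> [x xab] abc i; have /andP[axi xbi] := xab i.
pose y (t : R) : Vd := \row_j if j == i then t else x ord0 j.
have yab t : (a ord0 i < t <= b ord0 i)%R -> (c ord0 i - r < t <= c ord0 i + r)%R.
  move=> tab; have : box a b (y t).
    by move=> j; rewrite mxE; case: eqP => [->|_]; [exact: tab|exact: xab].
  by move=> /abc /in_cube /(_ i); rewrite mxE eqxx.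
apply/andP; split; last by have /andP[] := yab (b ord0 i) ltac:(lra).
rewrite leNgt; apply/negP => h.
(* If a_i < c_i - r, then x_i or c_i - r is an admissible i-th coordinate for the box that violates
   the strict lower bound of the cube. *)
have [xc|cx] := leP (x ord0 i) (c ord0 i - r)%R.
  have /andP[? _] := yab (x ord0 i) ltac:(lra); lra.
have /andP[? _] := yab (c ord0 i - r)%R ltac:(lra); lra.
Qed.

Lemma fundamental_lemma O h : open O -> lmeasurable O h ->
  (forall K, compact_in O K -> \int[mu]_(x in K) (`|h x|)%:E < +oo) ->
  (forall phi, Ccinf O phi -> \int[mu]_(x in O) (phi x * h x)%:E = 0) ->
  {ae mu, forall x, O x -> h x = 0%R}.
Proof.
move=> oO mh hK hphi.
have mO : measurable (O : set (Rd R d)) := measurable_open oO.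
have on_cube (c : Vd) (r : R) : (0 < r)%R -> cube c (2 * r) `<=` O ->
    {ae mu, forall x, cube c r x -> h x = 0%R}.
  move=> r0 cO; pose Q : set (Rd R d) := cube c r.
  have mQ : measurable Q by exact: measurable_box.
  (* A compact set between [cube c r] and [cube c (2 * r)], with a margin r/2 on the right only, the
     side on which bumps overshoot. *)
  pose K : set Vd := [set x | forall i, c ord0 i - r <= x ord0 i <= c ord0 i + 3 / 2 * r]%R.
  have cK : compact K.
    have := @rV_compact R d (fun i => `[c ord0 i - r, c ord0 i + 3 / 2 * r]%classic)%R
      (fun i => @segment_compact _ _ _).
    by congr compact; apply/seteqP; split => x xi i; have := xi i; rewrite /= in_itv.
  have KO : K `<=` O.
    move=> x Kx; apply: cO; apply/in_cube => i; have := Kx i.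
    by move=> /andP[? ?]; apply/andP; split; lra.
  have QK : Q `<=` K.
    move=> x /in_cube xQ i; have := xQ i.
    by move=> /andP[? ?]; apply/andP; split; lra.
  have mK : measurable (K : set (Rd R d)) by exact: measurable_compact.
  have mhK : lmeasurable K h by exact: measurable_funS mh.
  have ihK : mu.-integrable (K : set (Rd R d)) (EFin \o h).
    by apply/integrableP; split; [exact/measurable_EFinP|exact: hK].
  have box0 (a b : Vd) : box a b `<=` Q -> \int[mu]_(x in box a b) (h x)%:E = 0.
    move=> abQ.
    have [->|/set0P ab0] := eqVneq (box a b) set0; first by rewrite integral_set0.
    have abc := sub_cube_box ab0 abQ.
    have r2 : (0 < r / 2)%R by lra.
    (* From index [N] on the overshoot is below r/2, so the bumps are supported in [K]. *)
    have [N _ HN] := near_infty_natSinv_lt (PosNum r2).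
    pose u n (x : Vd) := box_bump a b (N + n) x.
    have Cu n : Ccinf O (u n).
      apply: box_bump_Ccinf => x xi; apply: KO => i; have := xi i; have := abc i.
      have := HN (N + n)%N (leq_addr _ _) => /=; move: ((N + n).+1%:R^-1)%R => q hq.
      by move=> /andP[? ?] /andP[? ?]; apply/andP; split; lra.
    have uK n x : ~ K x -> u n x = 0%R.
      move=> nKx; have [i xi] : exists i, ~~ (c ord0 i - r <= x ord0 i <= c ord0 i + 3 / 2 * r)%R.
        by apply/existsP; rewrite -negb_forall; apply: contra_notN nKx => /forallP.
      have /= := HN (N + n)%N (leq_addr _ _); have /andP[? ?] := abc i.
      move=> hr; apply: (@box_bump_eq0 _ _ _ _ _ _ i); move: xi hr.
      move: ((N + n).+1%:R^-1)%R => q xi hq; move: xi; rewrite negb_and -!ltNge => /orP[?|?]; apply/orP; [left|right]; lra.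
    have int0 n : \int[mu]_(x in K) (u n x * h x)%:E = 0.
      rewrite -(hphi _ (Cu n)) integral_mkcond [RHS]integral_mkcond.
      apply: eq_integral => x _; rewrite !patchE; case: ifPn => xK.
        by rewrite mem_set//; apply: KO; rewrite inE in xK.
      by case: ifPn => // _; rewrite uK ?mul0r// => Kx; rewrite mem_set in xK.
    have mu_ n : lmeasurable K (u n).
      apply: measurable_funS (measurable_open (@openT Vd)) (@subsetT _ _) _.
      apply: continuous_on_open_measurable; first exact: openT.
      by move=> x _; apply: bumps_continuous; exact: box_bump_bumps.
    have muh n : measurable_fun (K : set (Rd R d)) (fun x => (u n x * h x)%:E).
      by apply/measurable_EFinP; exact: (measurable_funM (mu_ n) mhK).
    have mbox : measurable (box a b : set (Rd R d)) := measurable_box a b.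
    have mind : measurable_fun (K : set (Rd R d)) (fun x => (\1_(box a b) x * h x)%:E).
      by apply/measurable_EFinP; apply: (measurable_funM _ mhK); exact: measurable_indic.
    have cvu : {ae mu, forall x, K x -> (u n x * h x)%:E @[n --> \oo] --> (\1_(box a b) x * h x)%:E}.
      apply: aeW => x _; apply: cvg_EFin; first exact: nearW.
      apply: cvgM; last exact: cvg_cst.
      have := @cvg_box_bump R d a b x; rewrite -(cvg_shiftn N).
      by under eq_fun do rewrite addnC.
    have bnd : {ae mu, forall x n, K x -> `|(u n x * h x)%:E| <= (`|h x|)%:E}.
      apply: aeW => x n _; rewrite abse_EFin lee_fin normrM ler_piMl//.
      by rewrite ger0_norm ?box_bump_ge0// box_bump_le1.
    have inth : mu.-integrable (K : set (Rd R d)) (fun x => (`|h x|)%:E).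
      exact: integrable_norm ihK.
    have [_ _] := dominated_convergence mK muh mind cvu inth bnd.
    rewrite /= (_ : (fun n => _) = cst 0); last by apply/funext => n; rewrite int0.
    move=> /cvg_lim; rewrite lim_cst// => /(_ _)/esym.
    rewrite (_ : \int[mu]_(x in K) _ = \int[mu]_(x in box a b) (h x)%:E); first by apply.
    have KE : box a b = K `&` box a b by rewrite setIidr//; exact: subset_trans QK.
    rewrite [in RHS]KE integral_mkcondr; apply: eq_integral => x _.
    by rewrite patchE indicE; case: ifP => _; rewrite ?mul1r ?mul0r.
  (* Extending by 0 outside [Q] gives a function integrable on the whole space; a box meets [Q] in a
     box contained in [Q]. *)
  have : {ae mu, forall x, (h \_ Q) x = 0%R}.
    apply: ae0_of_boxes.
      rewrite (_ : EFin \o _ = (EFin \o h) \_ Q); last first.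
        by apply/funext => x; rewrite /= !patchE; case: ifP.
      by apply/(integrable_mkcond _ mQ); exact: integrableS ihK.
    move=> a b; have [a' [b' QE]] : boxes (box a b `&` Q).
      by apply: boxes_setI; [exists a, b|exists (c - const_mx r)%R, (c + const_mx r)%R].
    rewrite -[RHS](box0 a' b'); last by rewrite -QE; exact: subIsetr.
    rewrite -QE [RHS]integral_mkcondr; apply: eq_integral => x _.
    by rewrite !patchE; case: ifP.
  apply: filterS => x + Qx; rewrite patchE mem_set//.
(* The exceptional sets of the countably many rational cubes are united by numbering the cubes with
   [pickle]. *)
pose good (qn : {ffun 'I_d -> rat} * nat) (x : Vd) :=
  cube (ratvec qn.1) (2 * qn.2.+1%:R^-1) `<=` O ->
  cube (ratvec qn.1) qn.2.+1%:R^-1 x -> h x = 0%R.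
have h0 n : {ae mu, forall x, if unpickle n is Some qn then good qn x else True}.
  case: unpickle => [qn|]; last exact: aeW.
  have [qnO|nqnO] := pselect (cube (ratvec qn.1 : Vd) (2 * qn.2.+1%:R^-1) `<=` O).
    have r0 : (0 < qn.2.+1%:R^-1 :> R)%R by rewrite invr_gt0 ltr0n.
    apply: (@filterS _ _ (ae_filter_ringOfSetsType mu) _ _ _ (on_cube _ _ r0 qnO)).
    by move=> x hx _; exact: hx.
  by apply: aeW => x /nqnO.
have := ae_foralln h0.
apply: (@filterS _ _ (ae_filter_ringOfSetsType mu)) => x hx Ox.
have [qn qnO xqn] : (\bigcup_(qn in [set qn : {ffun 'I_d -> rat} * nat |
    cube (ratvec qn.1) (2 * qn.2.+1%:R^-1) `<=` O])
    cube (ratvec qn.1) qn.2.+1%:R^-1) x by rewrite -(open_cubes oO).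
by have := hx (pickle qn); rewrite pickleK; exact.
Qed.

End fundamental_lemma.

(** * Pairing with a compactly supported kernel *)

Section pairing.
Context {R : realType} {d : nat}.
Local Notation Vd := 'rV[R]_d.
Local Notation mu := (lebesgue_d R d).
Implicit Types (f g w G : Vd -> R) (O K : set Vd).
Local Open Scope ereal_scope.

(* [filterS] does not find the filter instance of [mu] on its own. *)
Lemma aeS {P Q : Vd -> Prop} : {ae mu, forall x, P x} ->
  (forall x, P x -> Q x) -> {ae mu, forall x, Q x}.
Proof.
by move=> aP PQ; apply: (@filterS _ _ (ae_filter_ringOfSetsType mu) _ _ _ aP).
Qed.

Lemma aeS2 {P Q S : Vd -> Prop} : {ae mu, forall x, P x} ->
  {ae mu, forall x, Q x} -> (forall x, P x -> Q x -> S x) -> {ae mu, forall x, S x}.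
Proof.
move=> aP aQ PQS.
exact: (@filterS2 _ _ (ae_filter_ringOfSetsType mu) _ _ _ PQS aP aQ).
Qed.

Lemma lmeasurableM O f g : lmeasurable O f -> lmeasurable O g ->
  lmeasurable O (f \* g)%R.
Proof. exact: measurable_funM. Qed.

Lemma lmeasurableB O f g : lmeasurable O f -> lmeasurable O g ->
  lmeasurable O (f \- g)%R.
Proof. exact: measurable_funB. Qed.

Lemma lmeasurableV O f : lmeasurable O f -> lmeasurable O (fun x => (f x)^-1)%R.
Proof.
move=> mf.
(* 1/f = f |f|^(-2) reduces to measurability of a power map; both sides are 0 where f = 0. *)
rewrite (_ : (fun x => _) = fun x => (f x * (`|f x| `^ (-1)) ^+ 2)%R); last first.
  apply/funext => x; have [->|fx] := eqVneq (f x) 0%R; first by rewrite invr0 mul0r.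
  rewrite powR_inv1// exprVn real_normK ?num_real//.
  by rewrite expr2 invfM mulrA divff// mul1r.
apply: measurable_funM; first exact: mf.
apply: measurable_funX; apply: (measurableT_comp (measurable_powR (-1))).
by apply: measurableT_comp; [exact: normr_measurable|exact: mf].
Qed.

Lemma lmeasurableS O K f : measurable (O : set (Rd R d)) -> K `<=` O ->
  lmeasurable O f -> lmeasurable K f.
Proof. by move=> mO KO; exact: measurable_funS. Qed.

Lemma mulr_divD1_le (C e : R) : (0 <= C)%R -> (0 <= e)%R -> (C * (e / (C + 1)) <= e)%R.
Proof.
move=> C0 e0; rewrite mulrA ler_pdivrMr ?ltr_wpDl// mulrC ler_wpM2l//.
by rewrite lerDl.
Qed.

Section kernel.
Variables (O K : set Vd) (w G : Vd -> R) (C : R).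
Hypotheses (oO : open O) (KO : compact_in O K) (C0 : (0 <= C)%R)
  (mw : lmeasurable O w) (mG : lmeasurable O G)
  (G0 : forall x, O x -> ~ K x -> G x = 0%R)
  (GC : {ae mu, forall x, K x -> (`|G x| <= C * `|w x|)%R}).

Let mO : measurable (O : set (Rd R d)). Proof. exact: measurable_open. Qed.
Let mK : measurable (K : set (Rd R d)).
Proof. by case: KO => cK _; exact: measurable_compact. Qed.

Lemma pairing_le f : lmeasurable O f ->
  \int[mu]_(x in O) (`|f x * G x|)%:E <= C%:E * \int[mu]_(x in K) (`|f x * w x|)%:E.
Proof.
move=> mf; have KsO := KO.2.
have -> : \int[mu]_(x in O) (`|f x * G x|)%:E = \int[mu]_(x in K) (`|f x * G x|)%:E.
  rewrite integral_mkcond [RHS]integral_mkcond; apply: eq_integral => x _.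
  rewrite !patchE; case: (boolP (x \in K)) => xK.
    by rewrite mem_set//; apply: KsO; rewrite inE in xK.
  case: (boolP (x \in O)) => // xO; rewrite G0 ?mulr0 ?normr0//.
    by rewrite inE in xO.
  by move=> Kx; rewrite mem_set in xK.
exact: (weight_le mK C0 (lmeasurableS mO KsO mf) (lmeasurableS mO KsO mw)
  (lmeasurableS mO KsO mG) GC).
Qed.

Lemma pairing_integrable f : lmeasurable O f ->
  \int[mu]_(x in K) (`|f x * w x|)%:E < +oo ->
  mu.-integrable (O : set (Rd R d)) (fun x => (f x * G x)%:E).
Proof.
move=> mf fw; apply/integrableP; split.
  by apply/measurable_EFinP; exact: lmeasurableM.
apply: le_lt_trans (pairing_le mf) _.
by apply: lte_mul_pinfty; rewrite ?lee_fin.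
Qed.

(** Serves both sides of the defining identity of a weak derivative: with weight [w] and kernel d^a
    (v^(|a|+1) phi), and with weight v^(|a|+1) and kernel v^(|a|+1) phi. *)
Lemma pairing_cvg (u : nat -> Vd -> R) f : (forall n, lmeasurable O (u n)) ->
  lmeasurable O f ->
  (forall n, \int[mu]_(x in K) (`|u n x * w x|)%:E < +oo) ->
  \int[mu]_(x in K) (`|f x * w x|)%:E < +oo ->
  (forall e : R, (0 < e)%R -> exists N, forall n, (N <= n)%N ->
     \int[mu]_(x in K) (`|(u n x - f x) * w x|)%:E <= e%:E) ->
  \int[mu]_(x in O) (u n x * G x)%:E @[n --> \oo] --> \int[mu]_(x in O) (f x * G x)%:E.
Proof.
move=> mu_ mf uw fw cvgu.
have iu n := pairing_integrable (mu_ n) (uw n).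
have jf := pairing_integrable mf fw.
have fu n : \int[mu]_(x in O) (u n x * G x)%:E \is a fin_num.
  exact: integrable_fin_num.
have ff : \int[mu]_(x in O) (f x * G x)%:E \is a fin_num.
  exact: integrable_fin_num.
rewrite -(fineK ff); apply: cvg_EFin; first exact: nearW.
apply/cvgrPdist_le => e e0.
have C1 : (0 < C + 1)%R by rewrite ltr_wpDl.
have [N hN] := cvgu (e / (C + 1))%R (divr_gt0 e0 C1).
exists N => // n /hN {}hN.
rewrite /= -lee_fin -abse_EFin EFinB !fineK// -abseN oppeB ?fin_num_adde_defr// addeC.
rewrite -(@integralB_EFin _ (Rd R d) R mu O (u n \* G)%R (f \* G)%R mO (iu n) jf).
have mB := lmeasurableB (mu_ n) mf.
apply: le_trans (le_abse_integral mu mO _) _.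
  by apply/measurable_EFinP; apply: lmeasurableB; exact: lmeasurableM.
have -> : \int[mu]_(x in O) `|((u n \* G)%R x)%:E - ((f \* G)%R x)%:E| =
    \int[mu]_(x in O) (`|(u n x - f x) * G x|)%:E.
  by apply: eq_integral => x _; rewrite -EFinB -mulrBl.
apply: le_trans (pairing_le mB) _.
apply: (@le_trans _ _ (C%:E * (e / (C + 1))%:E)).
  by rewrite lee_wpmul2l// lee_fin.
by rewrite -EFinM lee_fin mulr_divD1_le// ltW.
Qed.

End kernel.

Lemma L1wlocB O w f g : open O -> lmeasurable O w ->
  L1wloc O w f -> L1wloc O w g -> L1wloc O w (f \- g)%R.
Proof.
move=> oO mw [mf fw] [mg gw]; split; first exact: lmeasurableB.
have mO := measurable_open oO.
move=> K KO; have [cK KsO] := KO; apply: integral_normB_lty.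
- exact: measurable_compact.
- exact: lmeasurableS mf.
- exact: lmeasurableS mg.
- exact: lmeasurableS mw.
- exact: fw.
- exact: gw.
Qed.

Lemma integral_norm_le_powR O K (p e : R) f : open O -> compact_in O K ->
  (1 <= p)%R -> (0 < e)%R -> lmeasurable O f ->
  \int[mu]_(x in K) (`|f x|)%:E <= e%:E * mu K +
    (e * e^-1 `^ p)%:E * \int[mu]_(x in O) (`|f x| `^ p)%:E.
Proof.
move=> oO [cK KsO] p1 e0 mf.
exact: integral_norm_le_powR_subset (measurable_compact cK) (measurable_open oO) KsO p1 e0 mf.
Qed.

Lemma Lpw_L1wloc O p w f : open O -> (1 <= p)%R -> lmeasurable O w ->
  Lpw p O w f -> L1wloc O w f.
Proof.
move=> oO p1 mw [mf fw]; split => // K KO.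
apply: le_lt_trans (integral_norm_le_powR oO KO p1 ltr01 (lmeasurableM mf mw)) _.
apply: lte_add_pinfty.
  by rewrite mul1e; apply: compact_finite; case: KO.
by apply: lte_mul_pinfty; rewrite ?lee_fin ?mulr_ge0 ?powR_ge0.
Qed.

Lemma cvg_Lp_L1loc O K p (u : nat -> Vd -> R) : open O -> compact_in O K ->
  (1 <= p)%R -> (forall n, lmeasurable O (u n)) ->
  (forall e : R, (0 < e)%R -> exists N, forall n, (N <= n)%N ->
     \int[mu]_(x in O) (`|u n x| `^ p)%:E <= e%:E) ->
  forall e : R, (0 < e)%R -> exists N, forall n, (N <= n)%N ->
     \int[mu]_(x in K) (`|u n x|)%:E <= e%:E.
Proof.
move=> oO KO p1 mu_ hu e e0.
have muK : mu K \is a fin_num.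
  by rewrite ge0_fin_numE// compact_finite//; case: KO.
pose k := fine (mu K); have k0 : (0 <= k)%R by rewrite fine_ge0.
have k1 : (0 < k + 1)%R by rewrite ltr_wpDl.
(* [e1] makes the term e1 mu(K) at most e/2, with [k + 1] covering a null [K]; only then is [N]
   chosen, to make the other term at most e/2. *)
pose e1 := (e / 2 / (k + 1))%R.
have e10 : (0 < e1)%R by rewrite !divr_gt0.
have c0 : (0 < e1 * e1^-1 `^ p)%R by rewrite mulr_gt0// powR_gt0// invr_gt0.
have [N hN] := hu (e / 2 / (e1 * e1^-1 `^ p))%R (divr_gt0 (divr_gt0 e0 (ltr0n _ 2)) c0).
exists N => n Nn; apply: le_trans (integral_norm_le_powR oO KO p1 e10 (mu_ n)) _.
apply: (@le_trans _ _ ((e / 2)%:E + (e / 2)%:E)); last first.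
  by rewrite -EFinD lee_fin -splitr.
apply: leeD.
  rewrite -(fineK muK) -/k -EFinM lee_fin /e1 mulrAC ler_pdivrMr//.
  by rewrite ler_wpM2l ?divr_ge0 ?(ltW e0)// lerDl.
apply: le_trans (lee_wpmul2l _ (hN n Nn)) _; first by rewrite lee_fin ltW.
by rewrite -EFinM lee_fin mulrC divfK// gt_eqF.
Qed.

End pairing.

(** * Weak derivatives *)

Section weak_derivative.
Context {R : realType} {d : nat}.
Local Notation Vd := 'rV[R]_d.
Local Notation mu := (lebesgue_d R d).
Implicit Types (f g w v G phi : Vd -> R) (O K : set Vd) (a : 'I_d -> nat).
Local Open Scope ereal_scope.

Lemma continuous_compact_bound O K f : compact_in O K ->
  (forall x, O x -> {for x, continuous f}) ->
  exists2 M : R, (0 <= M)%R & forall x, K x -> (`|f x| <= M)%R.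
Proof.
move=> [cK KO] cf.
have /compact_bounded[M [Mr hM]] : compact (f @` K).
  apply: continuous_compact cK; apply: continuous_in_subspaceT => x.
  by rewrite inE => /KO; exact: cf.
exists (`|M| + 1)%R => [|x Kx]; first by rewrite addr_ge0.
by apply: (hM (`|M| + 1)%R); [rewrite (le_lt_trans (ler_norm M))// ltrDl|exists x].
Qed.

Section kernels.
Variables (O : set Vd) (m : nat) (w v : Vd -> R).
Hypotheses (oO : open O) (mw : lmeasurable O w) (Cv : Ckstar m O v)
  (hw : forall K, compact_in O K -> exists C : R, (0 < C)%R /\
    {ae mu, forall x, K x -> (`|v x| <= C * `|w x|)%R}).

Let cv : forall x, O x -> {for x, continuous v}.
Proof. by case: Cv => /Ck_continuous. Qed.

Lemma lmeasurable_expv n : lmeasurable O (fun x => v x ^+ n)%R.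
Proof.
by apply: measurable_funX; exact: continuous_on_open_measurable.
Qed.

Lemma wder_kernels a phi : (mlen a <= m)%N -> Ccinf O phi -> exists K (C : R),
  [/\ compact_in O K, (0 <= C)%R,
   [/\ lmeasurable O (dpart a (fun y => v y ^+ (mlen a).+1 * phi y)%R),
    (forall x, O x -> ~ K x -> dpart a (fun y => v y ^+ (mlen a).+1 * phi y)%R x = 0%R) &
    {ae mu, forall x, K x ->
      (`|dpart a (fun y => v y ^+ (mlen a).+1 * phi y) x| <= C * `|w x|)%R}] &
   [/\ lmeasurable O (fun y => v y ^+ (mlen a).+1 * phi y)%R,
    (forall x, O x -> ~ K x -> (v x ^+ (mlen a).+1 * phi x = 0)%R) &
    forall x, K x -> (`|v x ^+ (mlen a).+1 * phi x| <= C * `|v x ^+ (mlen a).+1|)%R]].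
Proof.
move=> am [Cphi sphi]; set K := closure _ in sphi; case: (Cv) => Ckv _.
have phi0 x : ~ K x -> phi x = 0%R.
  move=> nKx; apply/eqP/negPn/negP => phx; apply: nKx.
  exact: subset_closure.
have [u cu uE] := dpart_expM oO Ckv (Cphi m) am.
have [M M0 hM] := continuous_compact_bound sphi cu.
have cphi := Ck_continuous (Cphi 0%N).
have [M' M'0 hM'] := continuous_compact_bound sphi cphi.
have [C [C0 hC]] := hw sphi.
(* [M] bounds the Leibniz cofactor on [K], [C] comes from (H), and [M'] bounds [phi]: one constant
   for both kernels. *)
exists K, (Num.max (M * C) M')%R; split => //.
- by rewrite le_max M'0 orbT.
- split.
  + apply: (@eq_measurable_fun _ _ (Rd R d) R O (v \* u)%R).
      by move=> x; rewrite inE => Ox; rewrite /= uE.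
    apply: continuous_on_open_measurable => // x Ox.
    by apply: continuousM; [exact: cv|exact: cu].
  (* The product vanishes on the open complement of [K], hence so do its derivatives there. *)
  + move=> x Ox nKx; have oK : open (~` K) by exact/closed_openC/closed_closure.
    rewrite (@dpart_eq_on _ _ (~` K) _ (cst 0%R))// ?dpart_cst0// => y nKy.
    by rewrite phi0// mulr0.
  + apply: (aeS hC) => x hx Kx; have Ox := sphi.2 x Kx.
    rewrite uE// normrM mulrC; apply: (@le_trans _ _ (M * (C * `|w x|))%R).
      by apply: ler_pM => //; [exact: hM|exact: hx].
    by rewrite mulrA ler_wpM2r// le_max lexx.
- split.
  + apply: continuous_on_open_measurable => // x Ox.
    apply: (@continuousM _ _ (fun y => v y ^+ (mlen a).+1)%R phi); last exact: cphi.
    by apply: (@continuous_comp _ _ _ v (fun t : R => t ^+ (mlen a).+1)%R);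
      [exact: cv|exact: exprn_continuous].
  + by move=> x _ nKx; rewrite phi0// mulr0.
  + move=> x Kx; rewrite normrM mulrC ler_wpM2r// le_max hM' ?orbT//.
Qed.

Lemma wder_integrable a f g phi : (mlen a <= m)%N -> Ccinf O phi ->
  L1wloc O w f -> L1wloc O (fun x => v x ^+ (mlen a).+1)%R g ->
  mu.-integrable (O : set (Rd R d))
    (fun x => (f x * dpart a (fun y => v y ^+ (mlen a).+1 * phi y) x)%:E) /\
  mu.-integrable (O : set (Rd R d))
    (fun x => (g x * (v x ^+ (mlen a).+1 * phi x))%:E).
Proof.
move=> am Cphi [mf fw] [mg gw].
have [K [C [KO C0 [mG1 G10 G1C] [mG2 G20 G2C]]]] := wder_kernels am Cphi.
split.
  exact: (pairing_integrable oO KO C0 mw mG1 G10 G1C mf (fw K KO)).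
have G2C' : {ae mu, forall x, K x ->
  (`|v x ^+ (mlen a).+1 * phi x| <= C * `|v x ^+ (mlen a).+1|)%R} by exact: aeW.
exact: (pairing_integrable oO KO C0 (lmeasurable_expv _) mG2 G20 G2C' mg (gw K KO)).
Qed.

Lemma wder_eqE a f g : is_wder O w v a f g <-> [/\ L1wloc O w f,
  L1wloc O (fun x => v x ^+ (mlen a).+1)%R g &
  forall phi, Ccinf O phi ->
  \int[mu]_(x in O) (f x * dpart a (fun y => v y ^+ (mlen a).+1 * phi y) x)%:E =
  ((-1) ^+ mlen a)%:E * \int[mu]_(x in O) (g x * (v x ^+ (mlen a).+1 * phi x))%:E].
Proof.
have E phi : \int[mu]_(x in O) (v x ^+ (mlen a).+1 * phi x * g x)%:E =
    \int[mu]_(x in O) (g x * (v x ^+ (mlen a).+1 * phi x))%:E.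
  by apply: eq_integral => x _; rewrite mulrC.
split=> [[? [? h]]|[? ? h]]; first by split => // phi /h ->; rewrite E.
by split => //; split => // phi /h ->; rewrite E.
Qed.

Lemma wderB a f f' g g' : (mlen a <= m)%N ->
  is_wder O w v a f g -> is_wder O w v a f' g' ->
  is_wder O w v a (f \- f')%R (g \- g')%R.
Proof.
move=> am /wder_eqE[fw gv fg] /wder_eqE[fw' gv' fg']; apply/wder_eqE; split.
- exact: L1wlocB.
- by apply: L1wlocB => //; exact: lmeasurable_expv.
move=> phi Cphi.
have [i1 i2] := wder_integrable am Cphi fw gv.
have [i1' i2'] := wder_integrable am Cphi fw' gv'.
have mO : measurable (O : set (Rd R d)) := measurable_open oO.
set G1 := dpart a _ in i1 i1' *.
transitivity (\int[mu]_(x in O) (((f \* G1)%R x)%:E - ((f' \* G1)%R x)%:E)).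
  by apply: eq_integral => x _; rewrite -EFinB -mulrBl.
rewrite (@integralB_EFin _ (Rd R d) R mu O (f \* G1)%R (f' \* G1)%R mO i1 i1').
rewrite fg// fg'// -muleBr//; last first.
  by rewrite fin_num_adde_defr//; exact: integrable_fin_num i2.
congr (_ * _).
pose G2 : Vd -> R := (fun x => v x ^+ (mlen a).+1 * phi x)%R.
rewrite -(@integralB_EFin _ (Rd R d) R mu O (g \* G2)%R (g' \* G2)%R mO i2 i2').
by apply: eq_integral => x _; rewrite -EFinB -mulrBl.
Qed.

(** The difference is a weak derivative of 0, so the fundamental lemma kills v^(|a|+1) (g - g'), and
    [v] is nonzero a.e. *)
Lemma wder_unique a f g g' : (mlen a <= m)%N ->
  is_wder O w v a f g -> is_wder O w v a f g' ->
  {ae mu, forall x, O x -> g x = g' x}.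
Proof.
move=> am fg fg'; have := wderB am fg fg' => /wder_eqE[_ [mB hB] eB].
have mO : measurable (O : set (Rd R d)) := measurable_open oO.
pose h : Vd -> R := (fun x => (g x - g' x) * v x ^+ (mlen a).+1)%R.
have h0 : {ae mu, forall x, O x -> h x = 0%R}.
  apply: fundamental_lemma => //.
    exact: (lmeasurableM mB (lmeasurable_expv _)).
  move=> phi Cphi; have := eB phi Cphi.
  have -> : \int[mu]_(x in O) ((f \- f)%R x *
      dpart a (fun y => v y ^+ (mlen a).+1 * phi y)%R x)%:E = 0.
    by rewrite -[RHS](integral0 mu O); apply: eq_integral => x _; rewrite /= subrr mul0r.
  have -> : \int[mu]_(x in O) (phi x * h x)%:E =
      \int[mu]_(x in O) ((g \- g')%R x * (v x ^+ (mlen a).+1 * phi x))%:E.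
    by apply: eq_integral => x _; congr EFin; rewrite /h /=; ring.
  move/esym/eqP; rewrite mule_eq0 => /orP[|/eqP//].
  by rewrite eqe signr_eq0.
case: Cv => _ v0; apply: (aeS2 h0 v0) => x hx vx Ox; apply/eqP; rewrite -subr_eq0.
have /eqP := hx Ox; rewrite /h mulf_eq0 => /orP[//|].
by rewrite expf_eq0/= (negbTE (vx Ox)).
Qed.

Lemma wder_closed a (u U : nat -> Vd -> R) f g : (mlen a <= m)%N ->
  (forall n, is_wder O w v a (u n) (U n)) -> L1wloc O w f ->
  L1wloc O (fun x => v x ^+ (mlen a).+1)%R g ->
  (forall K, compact_in O K -> forall e : R, (0 < e)%R -> exists N, forall n, (N <= n)%N ->
    \int[mu]_(x in K) (`|(u n x - f x) * w x|)%:E <= e%:E) ->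
  (forall K, compact_in O K -> forall e : R, (0 < e)%R -> exists N, forall n, (N <= n)%N ->
    \int[mu]_(x in K) (`|(U n x - g x) * v x ^+ (mlen a).+1|)%:E <= e%:E) ->
  is_wder O w v a f g.
Proof.
move=> am uU fw gv cu cU; apply/wder_eqE; split => // phi Cphi.
have [K [C [KO C0 [mG1 G10 G1C] [mG2 G20 G2C]]]] := wder_kernels am Cphi.
have G2C' : {ae mu, forall x, K x ->
  (`|v x ^+ (mlen a).+1 * phi x| <= C * `|v x ^+ (mlen a).+1|)%R} by exact: aeW.
have uw n : L1wloc O w (u n) by have /wder_eqE[] := uU n.
have Uv n : L1wloc O (fun x => v x ^+ (mlen a).+1)%R (U n) by have /wder_eqE[] := uU n.
have c1 := pairing_cvg oO KO C0 mw mG1 G10 G1C (fun n => (uw n).1) fw.1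
  (fun n => (uw n).2 K KO) (fw.2 K KO) (cu K KO).
have c2 := pairing_cvg oO KO C0 (lmeasurable_expv _) mG2 G20 G2C' (fun n => (Uv n).1) gv.1
  (fun n => (Uv n).2 K KO) (gv.2 K KO) (cU K KO).
have sfin : ((-1) ^+ mlen a)%:E \is a @fin_num R by [].
have c3 := cvgeZl sfin c2.
have E : (fun n => \int[mu]_(x in O) (u n x *
      dpart a (fun y => v y ^+ (mlen a).+1 * phi y)%R x)%:E) =
    (fun n => ((-1) ^+ mlen a)%:E *
      \int[mu]_(x in O) (U n x * (v x ^+ (mlen a).+1 * phi x))%:E).
  by apply/funext => n; have /wder_eqE[_ _ ->] := uU n.
rewrite E in c1; exact: cvg_unique c1 c3.
Qed.

End kernels.
End weak_derivative.

(** * Weighted Sobolev spaces *)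

Section weighted_sobolev.
Context {R : realType} {d : nat}.
Local Notation Vd := 'rV[R]_d.
Local Notation mu := (lebesgue_d R d).
Variables (O : set Vd) (p : R) (m : nat) (W : ('I_d -> nat) -> Vd -> R) (v : Vd -> R).
Local Notation w := (W (@alpha0 d)).
Local Notation D := (Dv O w v).
Local Open Scope ereal_scope.
Implicit Types (f g h : Vd -> R) (a b : 'I_d -> nat).

Definition Wterm a f : \bar R := \int[mu]_(x in O) (`|W a x * D a f x| `^ p)%:E.

Section norm.
Hypothesis p1 : (1 <= p)%R.
Let p0 : (0 < p)%R. Proof. exact: lt_le_trans p1. Qed.

Lemma Wterm_ge0 a f : 0 <= Wterm a f.
Proof. by apply: integral_ge0 => x _; rewrite lee_fin powR_ge0. Qed.

Lemma Wnorm_ge0 f : (0 <= Wnorm p m O W v f)%R.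
Proof. exact: powR_ge0. Qed.

(** All terms are assumed finite because [Wnorm] goes through [fine], which sends +oo to 0: an
    infinite term would make the norm vanish. *)
Lemma Wterm_le_Wnorm a f : (mlen a <= m)%N ->
  (forall b, (mlen b <= m)%N -> Wterm b f < +oo) ->
  Wterm a f <= (Wnorm p m O W v f `^ p)%:E.
Proof.
move=> am fin; rewrite /Wnorm -powRrM mulVf ?gt_eqF// powRr1; last first.
  by apply: fine_ge0; apply: sume_ge0 => b _; exact: Wterm_ge0.
have aS i : (a i < m.+1)%N.
  by rewrite ltnS (leq_trans _ am)// /mlen (bigD1 i)//= leq_addr.
pose b : {ffun 'I_d -> 'I_m.+1} := [ffun i => Ordinal (aS i)].
have bE : (fun i => nat_of_ord (b i)) = a by apply/funext => i; rewrite ffunE.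
rewrite fineK; last first.
  rewrite ge0_fin_numE; last by apply: sume_ge0 => c _; exact: Wterm_ge0.
  by apply: lte_sum_pinfty => c; exact: fin.
rewrite (bigD1 b)/= ?bE//; apply: leeDl.
by apply: sume_ge0 => c _; exact: Wterm_ge0.
Qed.

Lemma Wnorm_le (e : R) f : (0 < e)%R ->
  (forall b, (mlen b <= m)%N ->
    Wterm b f <= (e `^ p / (#|{ffun 'I_d -> 'I_m.+1}|.+1)%:R)%:E) ->
  (Wnorm p m O W v f <= e)%R.
Proof.
move=> e0 fe; rewrite -[leRHS](@powRr1 _ e) ?(ltW e0)// -[X in (_ <= _ `^ X)%R](@mulfV _ p) ?gt_eqF//.
rewrite powRrM; apply: ge0_ler_powR; rewrite ?nnegrE ?powR_ge0 ?invr_ge0 ?(ltW p0)//.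
  by apply: fine_ge0; apply: sume_ge0 => b _; exact: Wterm_ge0.
set c := (_ / _)%R in fe.
have c0 : (0 <= c)%R by rewrite divr_ge0 ?powR_ge0.
have S_le : \sum_(a : {ffun 'I_d -> 'I_m.+1} | (mlen (fun i => nat_of_ord (a i)) <= m)%N)
    Wterm (fun i => nat_of_ord (a i)) f <= (e `^ p)%:E.
  (* The sum is enlarged to all functions into ['I_m.+1], whose number is below the denominator of
     [c]. *)
  apply: (@le_trans _ _ (\sum_(a : {ffun 'I_d -> 'I_m.+1}) c%:E)).
    rewrite [leRHS](bigID (fun a : {ffun 'I_d -> 'I_m.+1} =>
      (mlen (fun i => nat_of_ord (a i)) <= m)%N))/=.
    apply: (@le_trans _ _ (\sum_(a : {ffun 'I_d -> 'I_m.+1} |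
      (mlen (fun i => nat_of_ord (a i)) <= m)%N) c%:E)); last first.
      by rewrite leeDl// sume_ge0.
    by apply: lee_sum => a; exact: fe.
  rewrite sumEFin lee_fin sumr_const -mulr_natr /c mulrAC ler_pdivrMr ?ltr0n//.
  by rewrite ler_wpM2l ?powR_ge0// ler_nat.
rewrite -lee_fin fineK// ge0_fin_numE ?(le_lt_trans S_le) ?ltry//.
by apply: sume_ge0 => b _; exact: Wterm_ge0.
Qed.

End norm.

Hypotheses (oO : open O) (p1 : (1 <= p)%R)
  (EW : forall a, (mlen a <= m)%N -> Ep p O (W a)) (Cv : Ckstar m O v)
  (HW : forall a, (mlen a <= m)%N -> forall K, compact_in O K ->
    exists C : R, (0 < C)%R /\
      {ae mu, forall x, K x -> (`|v x| ^+ (mlen a).+1 <= C * `|W a x|)%R}).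

Let p0 : (0 < p)%R. Proof. exact: lt_le_trans p1. Qed.
Let m0 : (mlen (@alpha0 d) <= m)%N. Proof. by rewrite mlen_alpha0. Qed.
Let mO : measurable (O : set (Rd R d)). Proof. exact: measurable_open. Qed.
Let mW a : (mlen a <= m)%N -> lmeasurable O (W a). Proof. by case/EW. Qed.

Let hw K : compact_in O K -> exists C : R, (0 < C)%R /\
  {ae mu, forall x, K x -> (`|v x| <= C * `|w x|)%R}.
Proof.
move=> /(HW m0)[C [C0 hC]]; exists C; split => //.
by apply: (aeS hC) => x; rewrite mlen_alpha0 expr1.
Qed.

Lemma weight_neq0 a : (mlen a <= m)%N -> {ae mu, forall x, O x -> W a x != 0%R}.
Proof.
move=> /EW[_ [_ Wpos]]; apply: (aeS Wpos) => x h /h.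
by apply: contraTneq => ->; rewrite normr0 powR0 ?gt_eqF// ltxx.
Qed.

Lemma Dv_wder a f : (0 < mlen a)%N -> (exists g, is_wder O w v a f g) ->
  is_wder O w v a f (D a f).
Proof. by move=> a0 ex; rewrite /Dv gtn_eqF//; exact: (getPex ex). Qed.

Lemma Dv0 a f : mlen a = 0%N -> D a f = f.
Proof. by rewrite /Dv => ->. Qed.

Lemma Dv_ae a f g : (0 < mlen a <= m)%N -> is_wder O w v a f g ->
  {ae mu, forall x, O x -> D a f x = g x}.
Proof.
move=> /andP[a0 am] fg; apply: (wder_unique oO (mW m0) Cv hw am _ fg).
by apply: Dv_wder => //; exists g.
Qed.

(** The existence half of [Wmem]: stable under subtraction and enough for [D] to respect differences
    a.e., without any norm estimate. *)
Definition wdiff f := forall a, (0 < mlen a <= m)%N -> exists g, is_wder O w v a f g.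

Lemma Wmem_wdiff f : Wmem p m O W v f -> wdiff f.
Proof. by move=> [_ h] a /h[]. Qed.

Lemma Wmem_Lpw a f : (mlen a <= m)%N -> Wmem p m O W v f -> Lpw p O (W a) (D a f).
Proof.
move=> am [fw h]; have [a0|a0] := posnP (mlen a).
  by rewrite (Dv0 _ a0) (mlen_eq0 a0); exact: fw.
by apply: (h a _).2; rewrite a0.
Qed.

Lemma wdiff_measurable a f : (mlen a <= m)%N -> wdiff f -> lmeasurable O f ->
  lmeasurable O (D a f).
Proof.
move=> am df mf; have [a0|a0] := posnP (mlen a); first by rewrite Dv0.
have [|g fg] := df a; first by rewrite a0.
by have [_ [[mD _] _]] := Dv_wder a0 (ex_intro _ g fg).
Qed.

Lemma wdiffB f g : wdiff f -> wdiff g -> wdiff (f \- g)%R.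
Proof.
move=> df dg a aP; have [f' ff'] := df a aP; have [g' gg'] := dg a aP.
exists (f' \- g')%R; apply: (wderB oO (mW m0) Cv hw _ ff' gg').
by case/andP: aP.
Qed.

Lemma DvB a f g : (mlen a <= m)%N -> wdiff f -> wdiff g ->
  {ae mu, forall x, O x -> D a (f \- g)%R x = (D a f x - D a g x)%R}.
Proof.
move=> am df dg; have [a0|a0] := posnP (mlen a).
  by rewrite !Dv0//; exact: aeW.
have aP : (0 < mlen a <= m)%N by rewrite a0.
apply: (Dv_ae aP); apply: (wderB oO (mW m0) Cv hw am).
  by apply: Dv_wder => //; exact: df.
by apply: Dv_wder => //; exact: dg.
Qed.

(** The function [h] is any a.e. version of the weighted derivative of [g]: [F a k] in the Cauchy
    condition, the L^p limit in the final convergence. *)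
Lemma WtermB a f g h : (mlen a <= m)%N -> wdiff f -> wdiff g ->
  lmeasurable O f -> lmeasurable O g -> lmeasurable O h ->
  {ae mu, forall x, O x -> (D a g x * W a x)%R = h x} ->
  Wterm a (f \- g)%R = \int[mu]_(x in O) (`|D a f x * W a x - h x| `^ p)%:E.
Proof.
move=> am df dg mf mg mh gh.
apply: (@integral_powR_ae R _ (Rd R d) mu).
- exact: mO.
- apply: lmeasurableM; first exact: mW.
  by apply: (wdiff_measurable am (wdiffB df dg)); exact: lmeasurableB.
- apply: lmeasurableB mh; apply: lmeasurableM; last exact: mW.
  exact: wdiff_measurable.
apply: (aeS2 gh (DvB am df dg)) => x hx Dx Ox.
by rewrite (Dx Ox) -(hx Ox) mulrC mulrBl.
Qed.

(** * The limit of a Cauchy sequence *)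

Section limit.
Variable u : nat -> Vd -> R.
Hypotheses (Wu : forall n, Wmem p m O W v (u n))
  (cauchy_u : forall e : R, (0 < e)%R -> exists N : nat, forall n k : nat,
     (N <= n)%N -> (N <= k)%N -> (Wnorm p m O W v (u n \- u k)%R < e)%R).

Let F a n : Vd -> R := (fun x => D a (u n) x * W a x)%R.

Let mF a n : (mlen a <= m)%N -> lmeasurable O (F a n).
Proof.
move=> am; apply: lmeasurableM; last exact: mW.
by have [] := Wmem_Lpw am (Wu n).
Qed.

Let mu_ n : lmeasurable O (u n). Proof. by case: (Wu n) => -[]. Qed.

Lemma Wterm_cauchyE a n k : (mlen a <= m)%N ->
  Wterm a (u n \- u k)%R = \int[mu]_(x in O) (`|F a n x - F a k x| `^ p)%:E.
Proof.
move=> am.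
apply: (WtermB am (Wmem_wdiff (Wu n)) (Wmem_wdiff (Wu k)) (mu_ n) (mu_ k) (mF k am)).
exact: aeW.
Qed.

Lemma Wterm_cauchy_lty a n k : (mlen a <= m)%N -> Wterm a (u n \- u k)%R < +oo.
Proof.
move=> am; rewrite Wterm_cauchyE//.
have [_ un] := Wmem_Lpw am (Wu n); have [_ uk] := Wmem_Lpw am (Wu k).
have uk' : \int[mu]_(x in O) (`|(\- F a k)%R x| `^ p)%:E < +oo.
  by under eq_integral do rewrite normrN; exact: uk.
exact: (integral_powRD_lty mO p1 (mF n am) (measurable_funN (mF k am)) un uk').
Qed.

Lemma Wlimit_Lp a : (mlen a <= m)%N -> exists h : Vd -> R, [/\ lmeasurable O h,
  \int[mu]_(x in O) (`|h x| `^ p)%:E < +oo &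
  forall e : R, (0 < e)%R -> exists N, forall n, (N <= n)%N ->
    \int[mu]_(x in O) (`|F a n x - h x| `^ p)%:E <= e%:E].
Proof.
move=> am; apply: (@Lp_complete R _ (Rd R d) mu O p mO p1 (F a)).
- by move=> n; exact: mF.
- by move=> n; have [] := Wmem_Lpw am (Wu n).
(* The norm is a p-th root, so the bound e^(1/p) on it bounds the p-th moment by e. *)
move=> e e0; have e'0 : (0 < e `^ p^-1)%R by rewrite powR_gt0.
have [N hN] := cauchy_u e'0; exists N => n k Nn Nk.
rewrite -Wterm_cauchyE//; apply: le_lt_trans (Wterm_le_Wnorm p1 am _) _.
  by move=> b bm; exact: Wterm_cauchy_lty.
rewrite lte_fin -[ltRHS](@powRr1 _ e) ?(ltW e0)//.
rewrite -[X in (_ < _ `^ X)%R](@mulVf _ p) ?gt_eqF// powRrM.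
by apply: gt0_ltr_powR; rewrite ?nnegrE ?powR_ge0 ?Wnorm_ge0// hN.
Qed.

Lemma Wlimit : exists f, Wmem p m O W v f /\
  (fun n => Wnorm p m O W v (u n \- f)%R) @ \oo --> (0%R : R).
Proof.
have /choice[h hP] : forall a, exists h : Vd -> R, (mlen a <= m)%N ->
    [/\ lmeasurable O h, \int[mu]_(x in O) (`|h x| `^ p)%:E < +oo &
    forall e : R, (0 < e)%R -> exists N, forall n, (N <= n)%N ->
      \int[mu]_(x in O) (`|F a n x - h x| `^ p)%:E <= e%:E].
  move=> a; have [am|_] := boolP (mlen a <= m)%N; last by exists (cst 0%R).
  by have [h hP] := Wlimit_Lp am; exists h.
pose g a : Vd -> R := (fun x => h a x * (W a x)^-1)%R.
have mh a : (mlen a <= m)%N -> lmeasurable O (h a) by case/hP.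
have mg a : (mlen a <= m)%N -> lmeasurable O (g a).
  by move=> am; apply: lmeasurableM; [exact: mh|exact/lmeasurableV/mW].
have gW a : (mlen a <= m)%N -> {ae mu, forall x, O x -> (g a x * W a x)%R = h a x}.
  move=> am; apply: (aeS (weight_neq0 am)) => x W0 /W0 {}W0.
  by rewrite /g -mulrA mulVf// mulr1.
have gLpw a : (mlen a <= m)%N -> Lpw p O (W a) (g a).
  move=> am; split; first exact: mg.
  have [_ hfin _] := hP a am.
  have mgW := lmeasurableM (mg a am) (mW am).
  by rewrite (integral_powR_ae p mO mgW (mh a am) (gW a am)).
have cvgL1 a : (mlen a <= m)%N -> forall K, compact_in O K ->
    forall e : R, (0 < e)%R -> exists N, forall n, (N <= n)%N ->
    \int[mu]_(x in K) (`|(D a (u n) x - g a x) * W a x|)%:E <= e%:E.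
  move=> am K KO; apply: (@cvg_Lp_L1loc R d O K p (fun n x => (D a (u n) x - g a x) * W a x)%R) => //.
    move=> n; apply: lmeasurableM; last exact: mW.
    by apply: lmeasurableB; [have [] := Wmem_Lpw am (Wu n)|exact: mg].
  move=> e e0; have [_ _ /(_ e e0)[N hN]] := hP a am; exists N => n /hN.
  have mDgW : lmeasurable O (fun x => (D a (u n) x - g a x) * W a x)%R.
    apply: lmeasurableM; last exact: mW.
    by apply: lmeasurableB; [have [] := Wmem_Lpw am (Wu n)|exact: mg].
  rewrite (integral_powR_ae p mO mDgW (lmeasurableB (mF n am) (mh a am)))//.
  by apply: (aeS (gW a am)) => x gx Ox; rewrite /= -(gx Ox) /F mulrBl.
pose f := g (@alpha0 d).
have wder_f a : (0 < mlen a <= m)%N -> is_wder O w v a f (g a).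
  move=> /andP[a0 am].
  (* The hypothesis on |v|^(|a|+1) turns local L^1 bounds with weight [W a] into bounds with weight
     v^(|a|+1), both for membership of [g a] and for convergence. *)
  have vW K : compact_in O K -> exists C : R, (0 <= C)%R /\
      {ae mu, forall x, K x -> (`|v x ^+ (mlen a).+1| <= C * `|W a x|)%R}.
    move=> /(HW am)[C [C0 hC]]; exists C; split; first exact: ltW.
    by apply: (aeS hC) => x; rewrite normrX.
  have mv := lmeasurable_expv oO Cv (mlen a).+1.
  have [mga gaL1] := Lpw_L1wloc oO p1 (mW am) (gLpw a am).
  have to_v K (C : R) f' : compact_in O K -> (0 <= C)%R -> lmeasurable O f' ->
      {ae mu, forall x, K x -> (`|v x ^+ (mlen a).+1| <= C * `|W a x|)%R} ->
      \int[mu]_(x in K) (`|f' x * v x ^+ (mlen a).+1|)%:E <=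
      C%:E * \int[mu]_(x in K) (`|f' x * W a x|)%:E.
    move=> [cK KO] C0 mf' hC.
    exact: (weight_le (measurable_compact cK) C0 (lmeasurableS mO KO mf')
      (lmeasurableS mO KO (mW am)) (lmeasurableS mO KO mv) hC).
  apply: (wder_closed oO (mW m0) Cv hw am (u := u) (U := fun n => D a (u n))).
  - by move=> n; apply: Dv_wder => //; apply: (Wmem_wdiff (Wu n)); rewrite a0.
  - exact: Lpw_L1wloc (mW m0) (gLpw _ m0).
  - split => // K KO; have [C [C0 hC]] := vW K KO.
    apply: le_lt_trans (to_v K C (g a) KO C0 mga hC) _.
    by apply: lte_mul_pinfty; rewrite ?lee_fin//; exact: gaL1.
  - by move=> K KO e e0; have [N hN] := cvgL1 _ m0 K KO e e0; exists N => n /hN; rewrite Dv0 ?mlen_alpha0.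
  move=> K KO e e0; have [C [C0 hC]] := vW K KO.
  have C1 : (0 < C + 1)%R by rewrite ltr_wpDl.
  have [N hN] := cvgL1 a am K KO _ (divr_gt0 e0 C1); exists N => n /hN {}hN.
  have mDg : lmeasurable O (D a (u n) \- g a)%R.
    by apply: lmeasurableB => //; have [] := Wmem_Lpw am (Wu n).
  apply: le_trans (to_v K C _ KO C0 mDg hC) _.
  by apply: le_trans (lee_wpmul2l _ hN) _; rewrite ?lee_fin// mulr_divD1_le// ltW.
have Wf : Wmem p m O W v f.
  split; first exact: gLpw.
  move=> a aP; have am : (mlen a <= m)%N by case/andP: aP.
  split; first by exists (g a); exact: wder_f.
  (* The representative chosen by [Dv] is only a.e. equal to [g a]; its integral is computed through
     [g a]. *)
  have [mga fga] := gLpw a am; have Dg := Dv_ae aP (wder_f a aP).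
  have mD : lmeasurable O (D a f).
    have a0 : (0 < mlen a)%N by case/andP: aP.
    by have [_ [[]]] := Dv_wder a0 (ex_intro _ _ (wder_f a aP)).
  split; first exact: mD.
  rewrite (integral_powR_ae p mO (lmeasurableM mD (mW am)) (lmeasurableM mga (mW am))).
    exact: fga.
  by apply: (aeS Dg) => x Dx Ox; rewrite /= (Dx Ox).
exists f; split => //.
have termE a n : (mlen a <= m)%N -> Wterm a (u n \- f)%R =
    \int[mu]_(x in O) (`|F a n x - h a x| `^ p)%:E.
  move=> am.
  apply: (WtermB am (Wmem_wdiff (Wu n)) (Wmem_wdiff Wf) (mu_ n) (mg _ m0) (mh a am)).
  have [a0|a0] := posnP (mlen a).
    by rewrite Dv0// /f -(mlen_eq0 a0); exact: gW.
  have aP : (0 < mlen a <= m)%N by rewrite a0.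
  by apply: (aeS2 (Dv_ae aP (wder_f a aP)) (gW a am)) => x Dx gx Ox; rewrite Dx// gx.
apply/cvgrPdist_le => e e0.
set c := #|{ffun 'I_d -> 'I_m.+1}|.+1.
have ec : (0 < e `^ p / c%:R)%R by rewrite divr_gt0 ?powR_gt0// ltr0n.
have /choice[N hN] : forall b : {ffun 'I_d -> 'I_m.+1}, exists N, forall n, (N <= n)%N ->
    (mlen (fun i => nat_of_ord (b i)) <= m)%N ->
    Wterm (fun i => nat_of_ord (b i)) (u n \- f)%R <= (e `^ p / c%:R)%:E.
  move=> b; have [bm|_] := boolP (mlen (fun i => nat_of_ord (b i)) <= m)%N; last by exists 0%N.
  have [_ _ /(_ _ ec)[N hN]] := hP _ bm.
  by exists N => n Nn _; rewrite termE//; exact: hN.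
(* Finitely many multi-indices occur, so the largest threshold works for all of them. *)
exists (\max_b N b)%N => // n /= Nn.
rewrite sub0r normrN ger0_norm ?Wnorm_ge0//.
apply: Wnorm_le => // a am.
have aS i : (a i < m.+1)%N.
  by rewrite ltnS (leq_trans _ am)// /mlen (bigD1 i)//= leq_addr.
pose b : {ffun 'I_d -> 'I_m.+1} := [ffun i => Ordinal (aS i)].
have bE : (fun i => nat_of_ord (b i)) = a by apply/funext => i; rewrite ffunE.
have := hN b n (leq_trans (leq_bigmax b) Nn); rewrite bE; exact.
Qed.

End limit.
End weighted_sobolev.

Unset Implicit Arguments.

Theorem theorem4 (R : realType) (d : nat) (Omega : set 'rV[R]_d) (p : R)
    (m : nat) (W : ('I_d -> nat) -> 'rV[R]_d -> R) (v : 'rV[R]_d -> R) :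
  open Omega ->
  1 <= p ->
  (forall a : 'I_d -> nat, (mlen a <= m)%N -> Ep p Omega (W a)) ->
  Ckstar m Omega v ->
  (forall a : 'I_d -> nat, (mlen a <= m)%N ->
     forall K : set 'rV[R]_d, compact_in Omega K ->
     exists C : R, 0 < C /\
       {ae lebesgue_d R d, forall x, K x -> `|v x| ^+ (mlen a).+1 <= C * `|W a x|}) ->
  (* completeness: every Cauchy sequence of W^{m,p}_{V,v}(Omega) converges
     in W^{m,p}_{V,v}(Omega) *)
  forall u : nat -> 'rV[R]_d -> R,
    (forall n, Wmem p m Omega W v (u n)) ->
    (forall e : R, 0 < e -> exists N : nat, forall n k : nat,
        (N <= n)%N -> (N <= k)%N -> Wnorm p m Omega W v (u n \- u k) < e) ->
    exists f : 'rV[R]_d -> R,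
      Wmem p m Omega W v f /\
      (fun n => Wnorm p m Omega W v (u n \- f)) @ \oo --> 0.
Proof.
move=> oO p1 EW Cv HW u Wu cauchy_u.
exact: (Wlimit oO p1 EW Cv HW Wu cauchy_u).
Qed.
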